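(* Assume Martin's Axiom (MA). Then there exists a subgroup $G$ of the topological group $2^{\mathfrak c}$ such that, with the subspace topology, $G$ is countably compact, $G$ has no non-trivial convergent sequences, and the square $G^2=G\times G$ (with the product topology) is not countably pracompact.
   Context: $\mathfrak c$ denotes the cardinality of the continuum. $2^{\mathfrak c}=\{0,1\}^{\mathfrak c}$ is the group of all functions $\mathfrak c\to\{0,1\}$ with coordinatewise addition modulo 2, equipped with the Tychonoff product topology of the discrete two-point spaces. Martin's Axiom is the statement: for every nonempty ccc partially ordered set $\mathbb P$ and every family $\mathcal D$ of fewer than $\mathfrak c$ dense subsets of $\mathbb P$ there is a filter on $\mathbb P$ meeting every member of $\mathcal D$. A space $X$ is countably compact if each countable open cover of $X$ has a finite subcover. A space $X$ is countably pracompact if there exists a dense subset $A$ of $X$ such that each infinite subset $B\subset A$ has an accumulation point in $X$. A non-trivial convergent sequence in $X$ is an injective sequence $\langle x_n : n\in\omega\rangle$ of points of $X$ that converges to some point of $X$. *)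

(* Defs.v *)
From HB Require Import structures.
From mathcomp Require Import all_boot all_order all_algebra.
From mathcomp Require Import all_classical all_reals all_analysis.

Set Implicit Arguments.
Unset Strict Implicit.
Unset Printing Implicit Defensive.

Import Order.TTheory GRing.Theory.

Local Open Scope classical_set_scope.
Local Open Scope card_scope.
Local Open Scope ring_scope.

(* The cardinal c = 2^omega is represented by the type of 0-1 sequences; only
   its cardinality is used, both as a bound and as an index set. *)
Definition continuum : Type := nat -> bool.

Definition card_lt (T U : Type) (A : set T) (B : set U) : Prop :=
  (A #<= B) /\ (A #!= B).

Section PosetNotions.
Context {d : Order.disp_t} {P : porderType d}.
Local Open Scope order_scope.

(* Forcing conventions: smaller elements are stronger conditions. *)
Definition compatible (p q : P) : Prop := exists r : P, r <= p /\ r <= q.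

Definition strong_antichain (A : set P) : Prop :=
  forall p q : P, A p -> A q -> p <> q -> ~ compatible p q.

Definition ccc : Prop := forall A : set P, strong_antichain A -> countable A.

Definition order_dense (D : set P) : Prop :=
  forall p : P, exists2 q : P, D q & q <= p.

Definition order_filter (F : set P) : Prop :=
  [/\ F !=set0,
      forall p q : P, F p -> p <= q -> F q
    & forall p q : P, F p -> F q -> exists r : P, [/\ F r, r <= p & r <= q]].

End PosetNotions.

Arguments ccc {d} P.

Definition martins_axiom : Prop :=
  forall (d : Order.disp_t) (P : porderType d) (D : set (set P)),
    [set: P] !=set0 -> ccc P ->
    card_lt D [set: continuum] ->
    (forall A : set P, D A -> order_dense A) ->
    exists2 F : set P, order_filter F & forall A : set P, D A -> F `&` A !=set0.

(* The library's [cover_compact], restricted to countable covers. *)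
Definition countably_compact (X : topologicalType) : Prop :=
  forall (I : choiceType) (D : set I) (f : I -> set X),
    countable D -> (forall i : I, D i -> open (f i)) ->
    [set: X] `<=` cover D f -> finite_subset_cover D f [set: X].

Definition countably_pracompact (X : topologicalType) : Prop :=
  exists2 A : set X, dense A &
    forall B : set X, B `<=` A -> infinite_set B -> limit_point B !=set0.

Definition nontrivial_convergent_sequence (X : topologicalType)
    (x : nat -> X) : Prop :=
  injective x /\ exists l : X, x @ \oo --> l.

(* The group structure is pointwise addition in the field [bool] of two
   elements, i.e. pointwise [addb]; [bool] carries the discrete topology. *)
Definition two_pow_continuum : Type := prod_topology (fun _ : continuum => bool).

HB.instance Definition _ := Topological.on two_pow_continuum.
HB.instance Definition _ :=
  GRing.Zmodule.copy two_pow_continuum (continuum -> bool).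

Definition subgroup (V : zmodType) (G : set V) : Prop := zmod_closed (mem G).

(* Main.v *)
(* A coordinate is a function [phi b : continuum -> bool], extended linearly to
   the free vector space over F_2 on [continuum]; a list [l] stands for the sum
   of its entries, so [ev (phi b) l] is the value of the coordinate at [l].  The
   group is the image of that vector space under all coordinates [phi b].

   The coordinates are built by recursion along a well-order of [continuum] with
   initial segments smaller than [continuum].  Every sequence [X] of distinct
   vectors is the sequence of some index [xi] above its supports, and [xi] is
   made an accumulation point of [X].  In the coordinates [b <= xi] this holds
   because [phi b xi] is defined as a limit of [phi b (X n)] along a fixed
   ultrafilter.  In the coordinates [b > xi] it holds because the restriction of
   [phi b] to indices below [b] is generic: whenever [X n] is close to [xi] in
   finitely many earlier coordinates for infinitely many [n], then the new
   coordinate agrees at [X n] and [xi] for infinitely many of these [n].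
   The requirements at one step are fewer than [continuum], and the poset is ccc.

   Genericity is compatible with asking, for a linearly independent sequence of
   pairs [(x n, y n)], that [phi b] never vanishes at both [x n] and [y n].  So
   every such sequence stays away from [(0, 0)].  Applied to tails of translates,
   this shows that an independent sequence of pairs has no accumulation point in
   the square of the group.  A dense subset of the square contains such a
   sequence, and a convergent sequence in the group would yield one that
   converges on the diagonal. *)
Require Import Defs.
From HB Require Import structures.
From mathcomp Require Import all_boot all_order all_algebra.
From mathcomp Require Import all_classical all_reals all_analysis wochoice.
Local Open Scope classical_set_scope.

Set Implicit Arguments.
Unset Strict Implicit.
Unset Printing Implicit Defensive.

(** * Cardinality *)

Definition embeds (A B : Type) : Prop := exists f : A -> B, injective f.

Lemma sval_inj (A : Type) (P : A -> Prop) : injective (@proj1_sig A P).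
Proof. by move=> [x Px] [y Py] /= xy; apply: eq_exist. Qed.

Lemma embeds_trans (A B C : Type) : embeds A B -> embeds B C -> embeds A C.
Proof. by move=> [f fI] [g gI]; exists (g \o f); apply: inj_comp. Qed.

(** A maximal partial injection is total or onto, since otherwise a pair of missing points could be
    added to its graph. *)
Lemma embeds_total (A B : Type) : embeds A B \/ embeds B A.
Proof.
pose P (R : set (A * B)) := forall p q, R p -> R q -> p.1 = q.1 <-> p.2 = q.2.
have [F FP Ftot|R [PR Rmax]] := @Zorn_bigcup _ P.
  move=> p q [X FX Xp] [Y FY Yq].
  have [XY|YX] := Ftot _ _ FX FY; first exact: (FP _ FY) (XY _ Xp) Yq.
  exact: (FP _ FX) Xp (YX _ Yq).
case: (pselect (forall a, exists b, R (a, b))) => [/choice[f Rf]|].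
  by left; exists f => a a' ff; apply/(PR _ _ (Rf a) (Rf a')).
case: (pselect (forall b, exists a, R (a, b))) => [/choice[f Rf] _|].
  by right; exists f => b b' ff; apply/(PR _ _ (Rf b) (Rf b')).
move=> /existsNP[b nb] /existsNP[a na]; exfalso.
apply: (Rmax (R `|` [set (a, b)])).
  split=> [p Rp|]; first by left.
  by move=> /(_ (a, b) (or_intror erefl)) Rab; apply: na; exists b.
move=> [c d] [c' d'] /= [Rp|[-> ->]] [Rq|[-> ->]] //=; first exact: (PR _ _ Rp Rq).
- by split=> E; exfalso; [apply: na; exists d|apply: nb; exists c]; rewrite -E.
- by split=> E; exfalso; [apply: na; exists d'|apply: nb; exists c']; rewrite E.
Qed.

(** * Squares of infinite sets *)

Section Square.
Variable U : Type.

Let field (R : set (U * U * U)) (a : U) : Prop := exists c, R (a, a, c).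

(** The graph of an injection of [A * A] into [A], with [A] read off the diagonal as [field R]:
    Zorn's lemma then runs over plain sets of triples. *)
Let pairing (R : set (U * U * U)) : Prop :=
  [/\ forall a b c, R (a, b, c) -> [/\ field R a, field R b & field R c],
      forall a b, field R a -> field R b -> exists c, R (a, b, c)
    & forall p q, R p -> R q -> p.1 = q.1 <-> p.2 = q.2].

Let pairing_fun R : pairing R ->
  exists2 f : {a | field R a} * {a | field R a} -> {a | field R a}, injective f &
    forall p, R (sval p.1, sval p.2, sval (f p)).
Proof.
move=> [RA Rtot RI].
suff /choice[f fR] : forall p : {a | field R a} * {a | field R a},
    exists c : {a | field R a}, R (sval p.1, sval p.2, sval c).
  exists f => // -[a b] [a' b'] ff.
  have [] : (sval a, sval b) = (sval a', sval b').
    by apply/(RI _ _ (fR (a, b)) (fR (a', b'))); rewrite /= ff.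
  by move=> /sval_inj -> /sval_inj ->.
move=> [[a Aa] [b Ab]] /=; have [c Rc] := Rtot a b Aa Ab.
by have [_ _ Ac] := RA _ _ _ Rc; exists (exist _ c Ac).
Qed.

(** Any two triples of the union lie in one pairing contained in it. Adjoining [R0] takes care of
    the empty chain. *)
Let pairing_bigcup (F : set (set (U * U * U))) (R0 : set (U * U * U)) :
  pairing R0 -> (forall X, F X -> pairing (X `|` R0)) -> total_on F subset ->
  pairing (\bigcup_(X in F) X `|` R0).
Proof.
move=> pR0 pF Ftot; set S := _ `|` R0.
have XS X : F X -> X `|` R0 `<=` S by move=> FX p [Xp|]; [left; exists X|right].
have SX p q : S p -> S q -> exists X, [/\ pairing X, X `<=` S, X p & X q].
  move=> [[X FX Xp]|Rp] [[Y FY Yq]|Rq].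
  - have [XY|YX] := Ftot _ _ FX FY.
      by exists (Y `|` R0); split; [exact: pF|exact: XS|left; exact: XY|left].
    by exists (X `|` R0); split; [exact: pF|exact: XS|left|left; exact: YX].
  - by exists (X `|` R0); split; [exact: pF|exact: XS|left|right].
  - by exists (Y `|` R0); split; [exact: pF|exact: XS|right|left].
  - by exists R0; split => // r; right.
split=> [a b c Sp|a b [c Sc] [d Sd]|p q Sp Sq].
- have [X [[XA _ _] sXS Xp _]] := SX _ _ Sp Sp.
  have [[a' ?] [b' ?] [c' ?]] := XA _ _ _ Xp.
  by split; [exists a'|exists b'|exists c']; exact: sXS.
- have [X [[_ Xtot _] sXS Xc Xd]] := SX _ _ Sc Sd.
  by have [||e ?] := Xtot a b; [exists c|exists d|exists e; exact: sXS].
- by have [X [[_ _ XI] _ Xp Xq]] := SX _ _ Sp Sq; apply: XI.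
Qed.

(* A pairing function on a set [A] extends to the union of [A] and a disjoint
   copy [e A]: the new pairs are labelled by elements of [A], hence of [e A]. *)
Let pairing_extend (R : set (U * U * U)) (i : nat -> {a | field R a})
    (e : {a | field R a} -> {a | ~ field R a}) :
  pairing R -> injective i -> injective e -> exists S, pairing S /\ R `<` S.
Proof.
move=> pR iI eI; have [f fI _] := pairing_fun pR; have [RA Rtot RI] := pR.
pose pt (t : bool) d := if t then sval (e d) else sval d.
have ptI t d t' d' : pt t d = pt t' d' -> t = t' /\ d = d'.
  case: t t' => [] [] /= E; split=> //.
  - exact/eI/sval_inj.
  - by case: (e d) E => x /= nx E; case: nx; rewrite E; exact: (svalP d').
  - by case: (e d) E => x /= nx E; case: nx; rewrite E; exact: (svalP d').
  - by case: (e d') E => x /= nx E; case: nx; rewrite -E; exact: (svalP d).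
  - by case: (e d') E => x /= nx E; case: nx; rewrite -E; exact: (svalP d).
  - exact: sval_inj.
pose k (t t' : bool) d d' := f (f (i t, i t'), f (d, d')).
have kI t1 t2 d1 d2 t1' t2' d1' d2' : k t1 t2 d1 d2 = k t1' t2' d1' d2' ->
    [/\ t1 = t1', t2 = t2', d1 = d1' & d2 = d2'].
  move=> /fI[/fI[/iI + /iI] + /fI[-> ->]].
  by move: t1 t2 t1' t2' => [] [] [] [].
pose N := [set p : U * U * U | exists t t' d d',
  (t || t') /\ p = (pt t d, pt t' d', pt true (k t t' d d'))].
have old d : field (R `|` N) (pt false d).
  by have [c ?] := svalP d; exists c; left.
have new d : field (R `|` N) (pt true d).
  by exists (pt true (k true true d d)); right; exists true, true, d, d.
have fieldE a : field (R `|` N) a -> exists t d, a = pt t d.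
  move=> [c [Rc|[t [t' [d [d' [_ [-> _ _]]]]]]]]; last by exists t, d.
  by have [Aa _ _] := RA _ _ _ Rc; exists false, (exist _ a Aa).
have ptA t d : field (R `|` N) (pt t d) by case: t.
exists (R `|` N); split; last first.
  split=> [p|]; first by left.
  move=> /(_ (pt true (i 0), pt true (i 0), pt true (k true true (i 0) (i 0)))).
  move=> sub; apply: (svalP (e (i 0))); exists (pt true (k true true (i 0) (i 0))).
  by apply: sub; right; exists true, true, (i 0), (i 0).
(* New triples have an argument and their value in the copy, while old ones lie within [field R]. *)
have dis p q : R p -> N q -> ~ (p.1 = q.1 \/ p.2 = q.2).
  case: p => [[a b] c] Rp [t [t' [d [d' [tt' ->]]]]] /=.
  have [Aa Ab Ac] := RA _ _ _ Rp.
  case=> [[Ea Eb]|Ec].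
    case/orP: tt' => E; [move: Aa; rewrite Ea E|move: Ab; rewrite Eb E].
      exact: (svalP (e d)).
    exact: (svalP (e d')).
  by move: Ac; rewrite Ec; exact: (svalP (e (k t t' d d'))).
split=> [a b c [Rc|[t [t' [d [d' [_ [-> -> ->]]]]]]]|a b|p q [Rp|Np] [Rq|Nq]].
- have [[a' ?] [b' ?] [c' ?]] := RA _ _ _ Rc.
  by split; [exists a'|exists b'|exists c']; left.
- by split; [exact: ptA|exact: ptA|exact: (ptA true)].
- move=> /fieldE[t [d ->]] /fieldE[t' [d' ->]].
  case E : (t || t').
    by exists (pt true (k t t' d d')); right; exists t, t', d, d'.
  case: t t' E => [] [] // _.
  have [c Rc] := Rtot _ _ (svalP d) (svalP d').
  by exists c; left.
- exact: RI.
- by split=> E; exfalso; apply: (dis p q) => //; [left|right].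
- by split=> E; exfalso; apply: (dis q p) => //; [left|right].
- case: Np => [t1 [t1' [d1 [d1' [_ ->]]]]]; case: Nq => [t2 [t2' [d2 [d2' [_ ->]]]]].
  by split=> /= [[/ptI[-> ->] /ptI[-> ->]]|/sval_inj/eI/kI[-> -> -> ->]].
Qed.

(** Let [A] be the field of a maximal pairing. By [pairing_extend] it does not embed into its
    complement, so the complement embeds into [A] and [U] into two tagged copies of [A], hence into
    [A]. *)
Lemma embeds_square : embeds nat U -> embeds (U * U) U.
Proof.
move=> [i iI]; pose k (p : nat * nat) := pickle p.
have kI : injective k by exact: pcan_inj pickleK.
pose R0 := [set p | exists m n, p = (i m, i n, i (k (m, n)))].
have R0f m : field R0 (i m) by exists (i (k (m, m))), m, m.
have pR0 : pairing R0.
  split=> [a b c [m [n [-> -> ->]]]|a b [_ [m [_ [-> _ _]]]] [_ [n [_ [-> _ _]]]]|].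
  - by split; exact: R0f.
  - by exists (i (k (m, n))), m, n.
  move=> _ _ [m [n ->]] [m' [n' ->]] /=; split.
    by move=> [/iI -> /iI ->].
  by move=> /iI/kI[-> ->].
have [F FP Ftot|R [pR Rmax]] := @Zorn_bigcup _ (fun R => pairing (R `|` R0)).
  exact: pairing_bigcup.
set S := R `|` R0 in pR.
have Smax S' : S `<` S' -> ~ pairing S'.
  move=> [SS' S'S] pS'; apply: (Rmax S').
    split=> [p Rp|]; first by apply: SS'; left.
    by move=> S'R; apply: S'S => p /S'R; left.
  by rewrite (_ : S' `|` R0 = S') //; apply/setUidPl => p ?; apply: SS'; right.
have [f fI _] := pairing_fun pR.
have Si m : field S (i m) by have [c ?] := R0f m; exists c; right.
pose j m : {a | field S a} := exist _ _ (Si m).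
have jI : injective j by move=> m n [] /iI.
have [[e eI]|[e eI]] := embeds_total {a | field S a} {a | ~ field S a}.
  by have [S' [pS' SS']] := pairing_extend pR jI eI; case: (Smax _ SS').
pose g u := match pselect (field S u) with
  | left Su => f (j 0, exist _ u Su)
  | right Su => f (j 1, e (exist _ u Su)) end.
have gI : injective g.
  move=> u v; rewrite /g; case: pselect => Hu; case: pselect => Hv /fI[].
  - by [].
  - by move=> /iI.
  - by move=> /iI.
  - by move=> /eI[].
exists (fun p => sval (f (g p.1, g p.2))) => -[u v] [u' v'] /sval_inj/fI[].
by move=> /gI-> /gI->.
Qed.
End Square.

Lemma card_le_embeds (A B : Type) : ([set: A] #<= [set: B])%card -> embeds A B.
Proof.
move=> /card_leP[f]; exists (fun a => sval (f (SigSub (mem_set (I : [set: A] a))))).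
move=> a b /val_inj /(inj (f := f)).
by rewrite !inE => /(_ I I) [].
Qed.

(** The iterated pairing is injective on lists of equal length, so the length is stored with it. *)
Lemma embeds_seq (U : Type) : embeds nat U -> embeds (seq U) U.
Proof.
move=> natU; have [f fI] := embeds_square natU; have [i iI] := natU.
pose code := foldr (fun x c => f (x, c)) (i 0).
have codeI l l' : size l = size l' -> code l = code l' -> l = l'.
  elim: l l' => [|x l IH] [|x' l'] //= [ll'] /fI[-> /IH-> //].
exists (fun l => f (i (size l), code l)) => l l' /fI[/iI ll'].
exact: codeI.
Qed.

Lemma embeds_continuum_fun : embeds (nat -> continuum) continuum.
Proof.
exists (fun u k => if unpickle k is Some (m, n) then u m n else false) => u v uv.
apply/funext => m; apply/funext => n.
by have := congr1 (@^~ (pickle (m, n))) uv; rewrite /= pickleK.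
Qed.

Lemma embeds_nat_continuum : embeds nat continuum.
Proof.
exists (fun n k => k == n) => m n /(congr1 (@^~ m)) /=.
by rewrite eqxx => /esym/eqP.
Qed.

(* Koenig's theorem for the continuum, via [c = c ^ omega]. *)
Lemma continuum_cover (X : Type) (A : nat -> set X) :
  embeds continuum X -> (forall x, exists n, A n x) ->
  exists n, embeds continuum {x | A n x}.
Proof.
move=> [j jI] Acov; apply: contrapT => /forallNP nA.
(* [t] is read as an array of bits. If every piece is small, the [n]-th rows of the [n]-th piece
   miss some [s n]; the array with rows [s n] then lies in no piece. *)
pose row (t : continuum) (n : nat) : continuum := fun m => t (pickle (n, m : nat)).
have /choice[s sP] : forall n, exists s, forall t, A n (j t) -> row t n <> s.
  move=> n; apply: contrapT => /forallNP H; apply: (nA n).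
  have /choice[g gP] : forall s, exists t, A n (j t) /\ row t n = s.
    move=> s; apply: contrapT => /forallNP Hs; apply: (H s) => t At rt.
    exact: (Hs t).
  exists (fun s => exist (A n) (j (g s)) (gP s).1) => s s' [/jI ss'].
  by rewrite -(gP s).2 -(gP s').2 ss'.
pose t : continuum := fun k => if unpickle k is Some (n, m) then s n m else false.
have [n An] := Acov (j t); apply: (sP n t An).
by apply/funext => m; rewrite /row /t pickleK.
Qed.

(** * Well-orders with small initial segments *)

Lemma well_order_lt (T : eqType) : exists lt : T -> T -> Prop,
  [/\ well_founded lt, forall x y z, lt x y -> lt y z -> lt x z
    & forall x y, [\/ lt x y, x = y | lt y x]].
Proof.
have [R Rwo] := well_ordering_principle T.
have Rmin (A : set T) : A !=set0 -> exists z, A z /\ forall x, A x -> R z x.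
  move=> [a Aa]; have [|z [[zA zmin] _]] := Rwo (mem A).
    by exists a; exact: mem_set.
  by exists z; split=> [|x Ax]; [exact: set_mem|apply: zmin; exact: mem_set].
have Rtot x y : R x y || R y x.
  have [|z [[->|->] zm]] := Rmin [set x; y]; first by exists x; left.
    by rewrite zm ?orbT //; right.
  by rewrite zm ?orbT //; left.
have Ranti x y : R x y -> R y x -> x = y.
  move=> xy yx; have [|z [[Az Azm] zU]] := Rwo (mem [set x; y]).
    by exists x; rewrite inE; left.
  have Rxx : R x x by have := Rtot x x; rewrite orbb.
  have Ryy : R y y by have := Rtot y y; rewrite orbb.
  rewrite -(zU x) ?(zU y) //; split; rewrite ?inE //=; try by [left|right].
    by move=> w; rewrite inE => -[->|->].
  by move=> w; rewrite inE => -[->|->].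
have Rtr x y z : R x y -> R y z -> R x z.
  move=> xy yz.
  have [|w [Aw wm]] := Rmin [set w | [\/ w = x, w = y | w = z]].
    by exists x; constructor 1.
  case: Aw wm => -> wm; first by apply: wm; constructor 3.
    by rewrite (Ranti x y xy) //; apply: wm; constructor 1.
  by rewrite -(Ranti y z yz) //; apply: wm; constructor 2.
exists (fun x y => R x y /\ x <> y); split.
- move=> x; apply: contrapT => nx.
  have [|z [nz zm]] := Rmin [set x | ~ Acc (fun x y => R x y /\ x <> y) x].
    by exists x.
  apply: nz; constructor => y [yz ny]; apply: contrapT => nAy.
  by apply: ny; apply: Ranti => //; exact: zm.
- move=> x y z [xy nxy] [yz nyz]; split; first exact: Rtr xy yz.
  by move=> xz; apply: nxy; apply: Ranti => //; rewrite xz.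
- move=> x y; have [->|/eqP nxy] := eqVneq x y; first by constructor 2.
  have /orP[xy|yx] := Rtot x y; first by constructor 1.
  by constructor 3; split=> // /esym.
Qed.

(** If some initial segment has size continuum, the order is pulled back along an embedding into the
    least such segment. *)
Lemma continuum_order : exists lt : continuum -> continuum -> Prop,
  [/\ well_founded lt, forall x y z, lt x y -> lt y z -> lt x z,
      forall x y, [\/ lt x y, x = y | lt y x]
    & forall x, ~ embeds continuum {y | lt y x}].
Proof.
have [lt [wf tr tot]] := well_order_lt (nat -> bool).
case: (pselect (exists x, embeds continuum {y | lt y x})); last first.
  by move=> /forallNP small; exists lt.
move=> [x0 x0P].
have [x [[h hI] xmin]] : exists x, embeds continuum {y | lt y x} /\
    forall z, lt z x -> ~ embeds continuum {y | lt y z}.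
  elim/(well_founded_ind wf): x0 x0P => x IH xP.
  case: (pselect (exists2 z, lt z x & embeds continuum {y | lt y z})).
    by move=> [z zx zP]; exact: IH zx zP.
  by move=> H; exists x; split=> // z zx zP; apply: H; exists z.
exists (fun y z => lt (sval (h y)) (sval (h z))); split.
- move=> y; move: {-1}(sval (h y)) (erefl (sval (h y))) => v.
  elim/(well_founded_ind wf): v y => v IH y yv; constructor => z zy.
  by apply: (IH (sval (h z))); rewrite ?yv -?yv.
- by move=> u v w; exact: tr.
- move=> u v; have [uv|uv|vu] := tot (sval (h u)) (sval (h v)).
  + by constructor 1.
  + by constructor 2; apply: hI; exact: sval_inj.
  + by constructor 3.
- move=> u [g gI]; apply: (xmin _ (svalP (h u))).
  exists (fun t => exist (fun y => lt y (sval (h u))) _ (svalP (g t))).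
  by move=> s t [/sval_inj/hI/sval_inj/gI].
Qed.

Section Enumeration.
Variable lt : continuum -> continuum -> Prop.
Hypothesis lt_tot : forall x y, [\/ lt x y, x = y | lt y x].
Hypothesis lt_small : forall x, ~ embeds continuum {y | lt y x}.

Lemma embeds_sequences : embeds ((nat -> seq continuum) * continuum) continuum.
Proof.
have [f fI] := embeds_seq embeds_nat_continuum.
have [g gI] := embeds_continuum_fun.
have [k kI] := embeds_square embeds_nat_continuum.
exists (fun p => k (g (fun n => f (p.1 n)), p.2)) => -[u t] [u' t'] /kI[/gI uu' ->].
by congr pair; apply/funext => n; apply: fI; exact: (congr1 (@^~ n) uu').
Qed.

(** Each [g] has continuum many codes [k (g, t)]. If none is above all entries of [g], each is at
    most one of countably many entries, so by [continuum_cover] continuum many codes lie below one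
    entry or coincide with it. *)
Lemma sequence_enumeration : exists E : continuum -> nat -> seq continuum,
  forall g, exists2 a, E a = g & forall n x, x \in (g n : seq (nat -> bool)) -> lt x a.
Proof.
have [k kI] := embeds_sequences.
have /choice[E EP] : forall a, exists g, forall h t, k (h, t) = a -> g = h.
  move=> a; case: (pselect (exists h t, k (h, t) = a)) => [[h [t <-]]|H].
    by exists h => h' t' /kI[].
  by exists (fun=> [::]) => h t kht; case: H; exists h, t.
exists E => g; apply: contrapT => H.
have kE t : E (k (g, t)) = g by exact: EP erefl.
pose pos (m : nat) : nat * nat := odflt (0, 0) (unpickle m).
pose s m := nth point (g (pos m).1 : seq (nat -> bool)) (pos m).2.
pose A m t := if odd m then lt (k (g, t)) (s m./2) else k (g, t) = s m./2.
have [||m [f fI]] := @continuum_cover continuum A.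
- by exists id.
- move=> t; apply: contrapT => /forallNP nA; apply: H; exists (k (g, t)) => //.
  move=> n x xg; pose m := pickle (n, index x (g n : seq (nat -> bool))).
  have sm : s m = x by rewrite /s /pos pickleK /= nth_index.
  have [//|xk|kx] := lt_tot x (k (g, t)).
    by case: (nA m.*2); rewrite /A odd_double doubleK sm.
  by case: (nA m.*2.+1); rewrite /A /= odd_double /= uphalf_double sm.
move: f fI; rewrite /A; case: (odd m) => f fI.
  apply: (@lt_small (s m./2)).
  exists (fun t => exist (fun y => lt y (s m./2)) _ (svalP (f t))).
  by move=> t t' [/kI[/sval_inj/fI]].
have ff : f (fun=> true) = f (fun=> false).
  have kk t : k (g, sval (f t)) = s m./2 := svalP (f t).
  by apply: sval_inj; have /kI[] := etrans (kk (fun=> true)) (esym (kk (fun=> false))).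
by have /(congr1 (@^~ 0)) := fI _ _ ff.
Qed.
End Enumeration.

(** Triples embed into lists over [U + nat], hence into [U + nat], which is infinite even if [U] is
    finite. By [continuum_cover] the continuum would embed into [U] or into a point. *)
Lemma small_index (U : Type) :
  ~ embeds continuum U -> ~ embeds continuum (U * seq U * nat).
Proof.
move=> Usmall Jbig; set B := (U + nat)%type.
have natB : embeds nat B by exists inr => m n [].
have [k kI] := embeds_seq natB.
have [h hI] : embeds continuum B.
  apply: embeds_trans Jbig _.
  exists (fun p => k (inl p.1.1 :: inr p.2 :: map inl p.1.2)).
  move=> [[u l] m] [[u' l'] m'] /kI /= [-> -> ll'].
  by congr (_, _, _); apply: (inj_map _ ll') => x y [].
pose A n (b : B) := match b with inl _ => n = 0 | inr m => n = m.+1 end.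
have [||[|n] [f fI]] := @continuum_cover B A.
- by exists h.
- by move=> [u|m]; [exists 0|exists m.+1].
- apply: Usmall.
  have /choice[g gP] : forall t, exists u, sval (f t) = inl u.
    by move=> t; case: (f t) => -[u|m] //= _; exists u.
  exists g => s t gst; apply: fI; apply: sval_inj.
  by rewrite (gP s) (gP t) gst.
have fE t : sval (f t) = inr n.
  by case: (f t) => -[u|m] //= [->].
have ff : f (fun=> true) = f (fun=> false) by apply: sval_inj; rewrite !fE.
by have /(congr1 (@^~ 0)) := fI _ _ ff.
Qed.

(** * Linear algebra over the two-element field *)

Definition ev (I : Type) (psi : I -> bool) (l : seq I) : bool :=
  \big[addb/false]_(i <- l) psi i.

Section Evaluation.
Variable I : eqType.
Implicit Types (psi : I -> bool) (l : seq I).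

Lemma ev_nil psi : ev psi [::] = false.
Proof. exact: big_nil. Qed.

Lemma ev_cons psi i l : ev psi (i :: l) = psi i (+) ev psi l.
Proof. exact: big_cons. Qed.

Lemma ev_cat psi l l' : ev psi (l ++ l') = ev psi l (+) ev psi l'.
Proof. exact: big_cat. Qed.

Lemma ev_seq1 psi i : ev psi [:: i] = psi i.
Proof. exact: big_seq1. Qed.

Lemma ev_flatten psi (J : Type) (x : J -> seq I) (K : seq J) :
  ev psi (flatten (map x K)) = ev (fun j => ev psi (x j)) K.
Proof. by rewrite /ev big_flatten big_map. Qed.

Lemma ev_addb psi psi' l :
  ev (fun i => psi i (+) psi' i) l = ev psi l (+) ev psi' l.
Proof. exact: big_split. Qed.

Lemma ev_filter psi (a : pred I) l : ev psi [seq i <- l | a i] = ev (fun i => a i && psi i) l.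
Proof.
rewrite /ev big_filter big_mkcond; apply: eq_bigr => i _.
by case: (a i).
Qed.

Lemma eq_ev psi psi' l : {in l, psi =1 psi'} -> ev psi l = ev psi' l.
Proof. exact: eq_big_seq. Qed.

Lemma ev_false psi l : {in l, psi =1 xpred0} -> ev psi l = false.
Proof. by move=> /eq_ev->; exact: big1_eq. Qed.

(** The coefficient function of the vector denoted by [l]; repeated entries cancel in pairs. *)
Definition ind l : I -> bool := fun i => ev (pred1 i) l.

Lemma indE l i : ind l i = odd (count_mem i l).
Proof. by rewrite /ind; elim: l => [|j l IH]; rewrite ?ev_nil// ev_cons IH oddD oddb. Qed.

Lemma ind_cat l l' i : ind (l ++ l') i = ind l i (+) ind l' i.
Proof. exact: ev_cat. Qed.

Lemma ind_mem l i : ind l i -> i \in l.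
Proof. by apply: contraLR => il; rewrite indE (count_memPn il). Qed.


Lemma iterop_addb n b : iterop n addb b false = odd n && b.
Proof.
elim: n => [|[|n] IH]; first by [].
  by [].
rewrite -[LHS]/(b (+) iterop n.+1 addb b false) {}IH /=.
by case: (odd n); case: b.
Qed.

Lemma ev_ind0 psi l : ind l =1 xpred0 -> ev psi l = false.
Proof.
move=> l0; rewrite /ev -big_undup_iterop_count big1_seq // => i _.
by have := l0 i; rewrite indE iterop_addb => ->.
Qed.

Lemma eq_ev_ind psi l l' : ind l =1 ind l' -> ev psi l = ev psi l'.
Proof.
move=> ll'; have : ev psi (l ++ l') = false.
  by apply: ev_ind0 => i; rewrite ind_cat ll' addbb.
by rewrite ev_cat; case: (ev psi l); case: (ev psi l').
Qed.

End Evaluation.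

Section Separation.
Local Open Scope ring_scope.
Import GRing.Theory.

(** A subgroup maximal among those containing [W] and missing [v] is the kernel of [chi]. *)
Lemma separating_functional (V : zmodType) (W : set V) (v : V) :
  (forall x : V, x + x = 0) -> W 0 -> (forall x y, W x -> W y -> W (x + y)) ->
  ~ W v ->
  exists chi : V -> bool, [/\ forall x y, chi (x + y) = chi x (+) chi y,
    forall x, W x -> chi x = false & chi v].
Proof.
move=> V2 W0 WD Wv.
have addKK (x y : V) : x + (x + y) = y by rewrite addrA V2 add0r.
pose P (A : set V) := ~ (A `|` W) v /\
  forall x y, (A `|` W) x -> (A `|` W) y -> (A `|` W) (x + y).
have [F FP Ftot|A [[Av AD] Amax]] := @Zorn_bigcup _ P.
  split=> [[[X FX Xv]|//]|x y].
    by have [Xnv _] := FP _ FX; apply: Xnv; left.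
  have step X a b : F X -> (X `|` W) a -> (X `|` W) b ->
      (\bigcup_(Z in F) Z `|` W) (a + b).
    move=> FX Xa Xb; have [_ /(_ _ _ Xa Xb)[Xab|]] := FP _ FX; last by right.
    by left; exists X.
  move=> [[X FX Xx]|Wx] [[Y FY Yy]|Wy]; last by right; exact: WD.
  - have [XY|YX] := Ftot _ _ FX FY.
      by apply: (step Y) => //; left => //; exact: XY.
    by apply: (step X) => //; left => //; exact: YX.
  - by apply: (step X) => //; [left|right].
  - by apply: (step Y) => //; [right|left].
set B := A `|` W in Av AD.
have B0 : B 0 by right.
(* The kernel [B] has index two: every [x] outside of it lies in [v + B]. *)
have Bmax x : ~ B x -> B (v + x).
  move=> Bx; apply: contrapT => Bvx.
  apply: (Amax (B `|` [set x + b | b in B])).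
    split=> [a Aa|sub]; first by left; left.
    by apply: Bx; left; apply: sub; right; exists 0; rewrite ?addr0.
  have WB : (B `|` [set x + b | b in B]) `|` W = B `|` [set x + b | b in B].
    by apply/setUidPl => w Ww; left; right.
  split; rewrite WB.
    move=> [//|[b Bb vE]]; apply: Bvx.
    by rewrite -vE addrAC V2 add0r.
  move=> a b [Ba|[a' Ba' <-]] [Bb|[b' Bb' <-]].
  - by left; exact: AD.
  - by right; exists (a + b'); [exact: AD|rewrite addrCA].
  - by right; exists (a' + b); [exact: AD|rewrite addrA].
  - by left; rewrite addrACA V2 add0r; exact: AD.
exists (fun x => ~~ `[< B x >]); split=> [x y|x Wx|].
- have cancel a b : B a -> B (a + b) -> B b.
    by move=> Ba /(AD _ _ Ba); rewrite addKK.
  case: (asboolP (B x)) => Bx; case: (asboolP (B y)) => By /=.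
  + by apply/negbTE; rewrite negbK; apply/asboolP; exact: AD.
  + by apply/asboolP => Bxy; apply: By; exact: cancel Bxy.
  + by apply/asboolP => Bxy; apply: Bx; apply: (cancel y); rewrite // addrC.
  + apply/negbTE; rewrite negbK; apply/asboolP.
    by have := AD _ _ (Bmax _ Bx) (Bmax _ By); rewrite addrACA V2 add0r.
- by apply/negbTE; rewrite negbK; apply/asboolP; right.
- by apply/negP => /asboolP.
Qed.

End Separation.

(** The functional is evaluated at unit vectors to get [psi]; by additivity [ev psi] recovers it on
    all finitely supported vectors. *)
Lemma separating_point (I : eqType) (W : set (I -> bool)) (l : seq I) :
  W xpred0 -> (forall v w, W v -> W w -> W (fun i => v i (+) w i)) ->
  ~ W (ind l) ->
  exists psi, ev psi l /\ forall l', W (ind l') -> ev psi l' = false.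
Proof.
move=> W0 WD Wl.
have [||||chi [chiD chiW chil]] := @separating_functional _ W (ind l).
- by move=> x; apply/funext => i; exact: addbb.
- exact: W0.
- exact: WD.
- exact: Wl.
have chiE l' : chi (ind l') = ev (fun i => chi (ind [:: i])) l'.
  elim: l' => [|i l' IH].
    rewrite ev_nil; apply: chiW; rewrite (_ : ind _ = xpred0) //.
    by apply/funext => i; rewrite /ind ev_nil.
  rewrite ev_cons -IH -chiD; congr chi; apply/funext => j.
  by rewrite -cat1s ind_cat.
exists (fun i => chi (ind [:: i])); rewrite -chiE; split => // l' Wl'.
by rewrite -chiE chiW.
Qed.

(** * Independent sequences of pairs *)

Section IndependentPairs.
Variable I : eqType.
Implicit Types (psi : I -> bool) (x y : nat -> seq I).

(** Joint linear independence of all [x n] and [y n]; [K] and [L] encode the coefficients by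
    parity. *)
Definition indep x y : Prop := forall K L : seq nat,
  ind (flatten (map x K) ++ flatten (map y L)) =1 xpred0 ->
  ind K =1 xpred0 /\ ind L =1 xpred0.

Definition hits psi x y : Prop := forall n, ev psi (x n) || ev psi (y n).

(** Take [psi] zero on sums of evenly many [x n] but not at [x 0]; as [x n ++ x 0] is such a sum,
    [psi] is nonzero at every [x n]. *)
Lemma hits_exists x y : indep x y -> exists psi, hits psi x y.
Proof.
move=> xy.
pose W := [set v | exists2 K, ~~ odd (size K) & v = ind (flatten (map x K))].
have [|||psi [psi0 psiW]] := @separating_point I W (x 0).
- by exists [::] => //; apply/funext => i; rewrite /ind ev_nil.
- move=> _ _ [K K2 ->] [L L2 ->]; exists (K ++ L).
    by rewrite size_cat oddD (negbTE K2) (negbTE L2).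
  by apply/funext => i; rewrite map_cat flatten_cat ind_cat.
- move=> [K K2 xK]; have [|K0 _] := xy (0 :: K) [::].
    by move=> i; rewrite /= cats0 ind_cat xK addbb.
  have evT (l : seq nat) : ev xpredT l = odd (size l).
    by elim: l => [|m l IH]; rewrite ?ev_nil// ev_cons IH.
  by have := ev_ind0 xpredT K0; rewrite evT /= K2.
exists psi => n; have := psiW (x n ++ x 0); rewrite ev_cat psi0 addbT.
move=> /(_ _)/negbFE-> //; exists [:: n; 0] => //=.
by rewrite cats0.
Qed.

Lemma eq_ind_split (K : seq nat) n :
  (forall i, n < i -> ~~ ind K i) ->
  ind K =1 ind ([seq i <- K | i < n] ++ (if ind K n then [:: n] else [::])).
Proof.
move=> Kn i; rewrite ind_cat indE (indE [seq j <- K | j < n]) count_filter.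
have [ltin|ltni|->] := ltngtP i n.
- rewrite (@eq_count _ (predI (pred1 i) (fun j => j < n)) (pred1 i)); last first.
    by move=> j /=; case: eqP => // ->; rewrite ltin.
  by case: ifP => _; rewrite /ind ?ev_seq1 ?ev_nil /= ?addbF// (gtn_eqF ltin) addbF.
- rewrite (@eq_count _ (predI (pred1 i) (fun j => j < n)) pred0); last first.
    by move=> j /=; case: eqP => // ->; rewrite ltnNge ltnW.
  rewrite count_pred0 -indE (negbTE (Kn _ ltni)).
  by case: ifP => _; rewrite /ind ?ev_seq1 ?ev_nil //= (ltn_eqF ltni).
- rewrite (@eq_count _ (predI (pred1 n) (fun j => j < n)) pred0); last first.
    by move=> j /=; case: eqP => // ->; rewrite ltnn.
  rewrite count_pred0 -indE /=.
  by case: ifP => _; rewrite /ind ?ev_seq1 ?ev_nil //= eqxx.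
Qed.

(** At the largest index [n'] of a nontrivial vanishing combination, [x n'], [y n'] or their sum
    equals a vector supported in [s n'], against freshness. *)
Lemma indep_fresh x y (s : nat -> seq I) :
  (forall m n, m < n -> {subset x m <= s n} /\ {subset y m <= s n}) ->
  (forall n l, {subset l <= s n} ->
    [/\ ind (x n) <> ind l, ind (y n) <> ind l & ind (x n ++ y n) <> ind l]) ->
  indep x y.
Proof.
move=> xys fresh K L KL0.
suff H n : ~~ (ind K n || ind L n).
  by split=> n; have := H n; rewrite negb_or => /andP[/negbTE Kn /negbTE Ln].
apply/negP => KLn.
have [||n' /orP KLn' max] := @ex_maxnP (fun n => ind K n || ind L n) (sumn (K ++ L)).
- by exists n.
- move=> i Hi; have iKL : i \in K ++ L.
    by rewrite mem_cat; case/orP: Hi => /ind_mem ->; rewrite ?orbT.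
  elim: (K ++ L) iKL => //= j l IH; rewrite inE => /orP[/eqP->|/IH li].
    exact: leq_addr.
  exact: leq_trans li (leq_addl _ _).
have split_at (z : nat -> seq I) (M : seq nat) : (forall i, n' < i -> ~~ ind M i) ->
    ind (flatten (map z M)) =1 ind (flatten (map z [seq i <- M | i < n']) ++
      if ind M n' then z n' else [::]).
  move=> Mn i; rewrite ind_cat -[LHS]/(ev (pred1 i) _) [LHS]ev_flatten.
  rewrite [LHS](eq_ev_ind _ (eq_ind_split Mn)) [LHS]ev_cat -ev_flatten; congr addb.
  by case: (ind M n'); rewrite ?ev_seq1 ?ev_nil // /ind ev_nil.
have Kn i : n' < i -> ~~ ind K i.
  by move=> ni; apply: contraTN ni => Ki; rewrite -leqNgt max // Ki.
have Ln i : n' < i -> ~~ ind L i.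
  by move=> ni; apply: contraTN ni => Li; rewrite -leqNgt max // Li orbT.
pose l := flatten (map x [seq i <- K | i < n']) ++ flatten (map y [seq i <- L | i < n']).
have ls : {subset l <= s n'}.
  move=> i; rewrite mem_cat => /orP[] /flattenP[w /mapP[m]];
    rewrite mem_filter => /andP[/xys[xs ys] _] ->; [exact: xs|exact: ys].
have lE : ind ((if ind K n' then x n' else [::]) ++ (if ind L n' then y n' else [::]))
    = ind l.
  apply/funext => i; have := KL0 i; rewrite !ind_cat (split_at x K Kn) (split_at y L Ln).
  by rewrite !ind_cat /=; do 4 case: (ind _ i).
have [fx fy fxy] := fresh n' l ls.
move: lE KLn'; case: (ind K n'); case: (ind L n') => /=; rewrite ?cats0 //.
by move=> _ [].
Qed.

Lemma pigeonhole_nat (F : finType) (c : nat -> F) : exists m n, m <> n /\ c m = c n.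
Proof.
apply: contrapT => H.
have cI : injective (fun i : 'I_#|F|.+1 => c i).
  by move=> i j ij; apply: val_inj => /=; apply: contrapT => nij; apply: H; exists i, j.
by have := leq_card _ cI; rewrite card_ord ltnn.
Qed.

(* [u n] and [u' n] are the two elements of the span of [x n] and [y n] on which
   [psi] is nonzero: [psi + chi] still hits the pair as soon as [chi] vanishes
   on one of them.  So a vector on which the constraints force a value lies in
   both [span u] and [span u'] up to a vector supported in [s], and these spans
   have trivial intersection. *)
Lemma avoid_forced x y psi (s : seq I) (h : nat -> seq I) :
  indep x y -> hits psi x y -> injective (fun n => ind (h n)) ->
  exists n psi', [/\ hits psi' x y, {in s, psi' =1 psi} & ev psi' (h n) = false].
Proof.
move=> xy hpsi hI; apply: contrapT => /forallNP forced.
pose a n := ev psi (x n); pose c n := ~~ (a n && ev psi (y n)).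
pose u n := if a n then x n else y n.
pose u' n := (if c n then x n else [::]) ++ y n.
(* If [h n] is outside the span of [w] modulo vectors supported in [s], some [chi] vanishes on these
   but not at [h n]. Then [psi] or [psi + chi] vanishes at [h n] and meets the constraints. *)
have span (w : nat -> seq I) : (forall n, ev psi (w n)) ->
    (forall n chi, ev chi (w n) -> ev chi (x n) || ev chi (y n)) ->
    forall n, exists K, forall i, i \notin s -> ind (h n ++ flatten (map w K)) i = false.
  move=> psiw wxy n.
  pose W := [set v : I -> bool | exists K, forall i, i \notin s ->
    v i (+) ind (flatten (map w K)) i = false].
  case: (pselect (W (ind (h n)))) => [[K KP]|nW].
    by exists K => i si; rewrite ind_cat KP.
  exfalso; have [||//|chi [chih chiW]] := @separating_point I W (h n).
  - by exists [::] => i _; rewrite /ind ev_nil.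
  - move=> v v' [K KP] [L LP]; exists (K ++ L) => i si.
    rewrite map_cat flatten_cat ind_cat.
    by have := KP i si; have := LP i si; do 4 case: (_ i).
  have chiw m : ev chi (w m) = false.
    by apply: chiW; exists [:: m] => i _ /=; rewrite cats0 addbb.
  have chis i : i \in s -> chi i = false.
    move=> si; rewrite -ev_seq1; apply: chiW; exists [::] => j sj.
    rewrite /ind ev_nil ev_seq1 /= addbF; apply/negbTE.
    by apply: contraNneq sj => <-.
  case E : (ev psi (h n)); last by apply: (forced n); exists psi; split.
  apply: (forced n); exists (fun i => psi i (+) chi i); split.
  - by move=> m; apply: wxy; rewrite ev_addb psiw chiw.
  - by move=> i si; rewrite chis // addbF.
  - by rewrite ev_addb E chih.
have psia n : ~~ a n -> ev psi (y n) by move=> na; have := hpsi n; rewrite -/(a n) (negbTE na).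
have /choice[K KP] : forall n, exists K, forall i, i \notin s ->
    ind (h n ++ flatten (map u K)) i = false.
  apply: span => [n|n chi]; rewrite /u; case: ifP => //; first by move=> /negbT/psia.
    by move=> _ ->.
  by move=> _ ->; rewrite orbT.
have /choice[K' KP'] : forall n, exists K, forall i, i \notin s ->
    ind (h n ++ flatten (map u' K)) i = false.
  apply: span => [n|n chi]; rewrite /u' ev_cat; last first.
    by case: (c n); rewrite ?ev_nil; case: (ev chi (x n)) => //=; rewrite addbF.
  have := hpsi n; rewrite /c -/(a n); case E : (a n); case: (ev psi (y n)) => //= _;
    by rewrite ?ev_nil // -/(a n) E.
(* The errors are supported in the finite list [s], so two indices share both of them. Hence
   [h m + h n] lies in both spans. *)
have [m [n [mn]]] := @pigeonhole_nat _ (fun n => map_tuple (fun i =>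
  (ind (h n ++ flatten (map u (K n))) i, ind (h n ++ flatten (map u' (K' n))) i))
  (in_tuple s)).
move=> /(congr1 val)/= /eq_in_map code.
apply: mn; apply: hI; apply/funext => i.
have uE j : ind (h m ++ flatten (map u (K m))) j = ind (h n ++ flatten (map u (K n))) j.
  by have [/code[]//|sj] := boolP (j \in s); rewrite !KP.
have u'E j : ind (h m ++ flatten (map u' (K' m))) j = ind (h n ++ flatten (map u' (K' n))) j.
  by have [/code[]//|sj] := boolP (j \in s); rewrite !KP'.
pose M := K m ++ K n; pose M' := K' m ++ K' n.
have [|H1 H2] := xy ([seq k <- M | a k] ++ [seq k <- M' | c k]) ([seq k <- M | ~~ a k] ++ M').
  move=> j.
  have fu (L : seq nat) : ind (flatten (map u L)) j =
      ind (flatten (map x [seq k <- L | a k])) j (+) ind (flatten (map y [seq k <- L | ~~ a k])) j.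
    rewrite /ind !ev_flatten !ev_filter -ev_addb; apply: eq_ev => k _.
    by rewrite /u; case: (a k) => /=; rewrite ?addbF.
  have fu' (L : seq nat) : ind (flatten (map u' L)) j =
      ind (flatten (map x [seq k <- L | c k])) j (+) ind (flatten (map y L)) j.
    rewrite /ind !ev_flatten !ev_filter -ev_addb; apply: eq_ev => k _.
    by rewrite /u' ev_cat; case: (c k); rewrite ?ev_nil.
  have := uE j; have := u'E j; rewrite !ind_cat !fu !fu' !map_cat !filter_cat !map_cat.
  rewrite !flatten_cat !ind_cat.
  by do 14 case: (ind _ j) => //=.
have M0 : ind M =1 xpred0.
  move=> k.
  have fE (p : pred nat) (L : seq nat) : ind [seq k <- L | p k] k = p k && ind L k.
    rewrite /ind ev_filter; case pk : (p k); last first.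
      by apply: ev_false => l _ /=; apply/negP => /andP[+ /eqP E]; rewrite E pk.
    by apply: eq_ev => l _ /=; case: eqP => [->|_]; rewrite ?pk ?andbF.
  have h1 : (a k && ind M k) (+) (c k && ind M' k) = false by rewrite -!fE -ind_cat H1.
  have h2 : (~~ a k && ind M k) (+) ind M' k = false.
    by rewrite -(fE (fun k => ~~ a k)) -ind_cat H2.
  move: h1 h2; rewrite /c.
  by case: (a k); case: (ind M k); case: (ind M' k); rewrite //= andbF.
have := uE i; rewrite !ind_cat => /(canRL (addbK _)); rewrite -addbA -ind_cat.
rewrite -flatten_cat -map_cat => ->.
rewrite [X in _ (+) X](_ : _ = false) ?addbF //.
rewrite /ind ev_flatten; apply: ev_ind0 => k; rewrite ind_cat addbC -ind_cat.
exact: M0.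
Qed.

End IndependentPairs.

(** * The forcing notion *)

Section Forcing.
Variables x y : nat -> seq continuum.

Definition basic (s : seq continuum) (psi : continuum -> bool) :
    set (continuum -> bool) :=
  [set chi | hits chi x y /\ {in s, chi =1 psi}].

(* A condition is identified with its set of possible extensions; this makes
   the forcing relation antisymmetric. *)
Definition condition : Type :=
  {U : set (continuum -> bool) | exists s psi, hits psi x y /\ U = basic s psi}.

HB.instance Definition _ := gen_eqMixin condition.
HB.instance Definition _ := gen_choiceMixin condition.

Definition condition_le (p q : condition) : bool := `[< sval p `<=` sval q >].

Lemma condition_le_refl : reflexive condition_le.
Proof. by move=> p; apply/asboolP. Qed.

Lemma condition_le_anti : antisymmetric condition_le.
Proof.
move=> p q /andP[/asboolP pq /asboolP qp].
by apply: sval_inj; rewrite eqEsubset.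
Qed.

Lemma condition_le_trans : transitive condition_le.
Proof.
move=> q p r /asboolP pq /asboolP qr; apply/asboolP.
exact: subset_trans pq qr.
Qed.

Fact condition_display : Order.disp_t. Proof. exact: Order.Disp tt tt. Qed.

HB.instance Definition _ := Order.Le_isPOrder.Build condition_display condition
  condition_le_refl condition_le_anti condition_le_trans.

Lemma condition_leP (p q : condition) :
  reflect (sval p `<=` sval q) (p <= q)%O.
Proof. exact: asboolP. Qed.

Definition basic_condition s psi (psiP : hits psi x y) : condition :=
  exist _ (basic s psi) (ex_intro _ s (ex_intro _ psi (conj psiP erefl))).

Lemma prefix_separates (s : seq continuum) : exists k, {in s &, forall a b,
  mkseq a k = mkseq b k -> a = b}.
Proof.
have diff (a b : continuum) : exists k, mkseq a k = mkseq b k -> a = b.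
  case: (pselect (exists n, a n <> b n)) => [[n abn]|ab]; last first.
    by exists 0 => _; apply/funext => n; apply: contrapT => abn; apply: ab; exists n.
  exists n.+1 => /(congr1 (nth false ^~ n)).
  by rewrite !nth_mkseq // => /abn.
have /choice[d dP] : forall p : continuum * continuum,
    exists k, mkseq p.1 k = mkseq p.2 k -> p.1 = p.2.
  by move=> [a b]; exact: diff.
exists (\max_(a <- s) \max_(b <- s) d (a, b)) => a b sa sb ab.
apply: (dP (a, b)) => /=.
have dk : d (a, b) <= \max_(a <- s) \max_(b <- s) d (a, b).
  rewrite (big_rem a) //= leq_max; apply/orP; left.
  by rewrite (big_rem b) //= leq_max leqnn.
apply: (@eq_from_nth _ false); rewrite ?size_mkseq // => i id.
have := congr1 (nth false ^~ i) ab.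
by rewrite !nth_mkseq // (leq_trans id).
Qed.

(** There are countably many labels, and conditions with equal labels are compatible: [psi] is used
    on [s] and on the countable set [C] of entries of [x] and [y], which decides [hits], and [chi]
    elsewhere. *)
Lemma condition_ccc : ccc condition.
Proof.
pose C := [set a : continuum | exists n, a \in x n ++ y n].
have /countable_injP[code codeI] : countable C.
  rewrite (_ : C = \bigcup_(n in [set: nat]) [set` x n ++ y n]).
    by apply: bigcup_countable => // n _; apply: finite_set_countable; exact: finite_seq.
  by apply/seteqP; split=> [a [n an]|a [n _ an]]; exists n.
pose label k s (psi : continuum -> bool) :=
  (k, [seq (mkseq a k, psi a) | a <- s], [seq code a | a <- s & `[< C a >]]).
have /choice[lab labP] : forall p : condition, exists l, exists s psi k,
    [/\ hits psi x y, sval p = basic s psi, l = label k s psi &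
        {in s &, forall a b, mkseq a k = mkseq b k -> a = b}].
  move=> p; have [s [psi [psiP pE]]] := svalP p; have [k kP] := prefix_separates s.
  by exists (label k s psi), s, psi, k.
move=> A Aanti; apply/countable_injP; exists (fun p => pickle (lab p)) => p q.
rewrite !inE => Ap Aq /(pcan_inj pickleK) pq; apply: contrapT => npq.
apply: (Aanti p q) => //.
have [s [psi [k [psiP pE lpE sk]]]] := labP p.
have [t [chi [k' [chiP qE lqE tk]]]] := labP q.
move: pq; rewrite lpE lqE => -[kk' L1 L2]; rewrite -{k'}kk' in L1 tk lqE.
pose mix a := if `[< C a >] || (a \in s) then psi a else chi a.
have mixs : {in s, mix =1 psi} by move=> a sa; rewrite /mix sa orbT.
have mixC a : C a -> mix a = psi a by move=> Ca; rewrite /mix (asboolT Ca).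
have mixt : {in t, mix =1 chi}.
  (* An entry of [t] in [C] has its code in the label, so it is in [s]. For an entry [a] of both
     lists the truncated graphs give [psi a = chi a], because [k] separates the entries of [t]. *)
  move=> a ta; rewrite /mix; case: ifP => // Csa.
  have sa : a \in s.
    case/orP: Csa => // /asboolP Ca.
    have : code a \in [seq code a | a <- t & `[< C a >]].
      by apply: map_f; rewrite mem_filter ta andbT; apply/asboolP.
    rewrite -L2 => /mapP[b]; rewrite mem_filter => /andP[/asboolP Cb sb].
    by move=> /codeI; rewrite !inE => -> //.
  have : (mkseq a k, psi a) \in [seq (mkseq a k, chi a) | a <- t].
    by rewrite -L1; apply/mapP; exists a.
  by move=> /mapP[b tb [ab ->]]; rewrite (tk a b).
have mixP : hits mix x y.
  move=> n; rewrite (@eq_ev _ mix psi) 1?(@eq_ev _ mix psi (y n)) ?psiP //.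
    by move=> a ya; apply: mixC; exists n; rewrite mem_cat ya orbT.
  by move=> a xa; apply: mixC; exists n; rewrite mem_cat xa.
exists (basic_condition (s ++ t) mixP); split; apply/condition_leP => chi' [chi'P chi'E].
  by rewrite pE; split => // a sa; rewrite chi'E ?mixs // mem_cat sa.
by rewrite qE; split => // a ta; rewrite chi'E ?mixt // mem_cat ta orbT.
Qed.

(** [D j] consists of the conditions that force some [h j n] to zero; it is dense by [avoid_forced],
    and Martin's Axiom gives a filter meeting all of them. *)
Lemma generic_functional (J : Type) (h : J -> nat -> seq continuum) :
  martins_axiom -> embeds J continuum -> ~ embeds continuum J -> indep x y ->
  (forall j, injective (fun n => ind (h j n))) ->
  exists psi, hits psi x y /\ forall j, exists n, ev psi (h j n) = false.
Proof.
move=> MA [jJ jJI] Jsmall xy hI.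
pose D j := [set p : condition | exists n, forall chi, sval p chi -> ev chi (h j n) = false].
have [psi0 psi0P] := hits_exists xy.
have [||||F [F0 Fup Fdir] FD] := MA _ condition [set D j | j in [set: J]].
- by exists (basic_condition [::] psi0P).
- exact: condition_ccc.
- have DJ : ([set D j | j in [set: J]] #<= [set: J])%card by exact: card_image_le.
  split.
    apply: card_le_trans DJ _; apply/pcard_injP; exists jJ; exact: in2W.
  apply/negP => /card_eqPle[_ /card_le_trans/(_ DJ)] TJ.
  exact/Jsmall/card_le_embeds.
- move=> _ [j _ <-] p; have [s [psi [psiP UE]]] := svalP p.
  have [n [psi' [psi'P psi's psi'h]]] := avoid_forced s xy psiP (hI j).
  exists (basic_condition (s ++ h j n) psi'P).
    exists n => chi [chiP chiE]; rewrite -psi'h; apply: eq_ev => a ah.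
    by apply: chiE; rewrite mem_cat ah orbT.
  apply/condition_leP => chi [chiP chiE] /=; rewrite UE; split => // a sa.
  by rewrite chiE ?psi's // mem_cat sa.
(* The conditions in [F] are sets of functionals; [psi] is a pointwise limit along an ultrafilter
   containing them. *)
have FF : ProperFilter (filter_from F sval).
  apply: filter_from_proper; first apply: filter_from_filter => //.
    move=> p q Fp Fq; have [r [Fr /condition_leP rp /condition_leP rq]] := Fdir p q Fp Fq.
    by exists r => // chi rchi; split; [exact: rp|exact: rq].
  by move=> p _; have [s [psi [psiP ->]]] := svalP p; exists psi; split.
have [G [GU FG]] := ultraFilterLemma FF.
pose psi a := `[< G [set chi : continuum -> bool | chi a] >].
have psiG (s : seq continuum) : G [set chi : continuum -> bool | {in s, chi =1 psi}].
  elim: s => [|a s IH].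
    by apply: filterS filterT => chi _ a.
  have Ga : G [set chi : continuum -> bool | chi a = psi a].
    rewrite /psi; case: asboolP => Ha; first by apply: filterS Ha.
    have [//|] := in_ultra_setVsetC [set chi : continuum -> bool | chi a] GU.
    by apply: filterS => chi /negP/negbTE.
  apply: filterS (filterI IH Ga) => chi [Hs Ha] b; rewrite inE => /orP[/eqP->//|].
  exact: Hs.
(* Each instance of the conclusions looks at finitely many values, on which [psi] agrees with a
   member of any given condition in [F]. *)
have meets (p : condition) (s : seq continuum) :
    F p -> exists2 chi, sval p chi & {in s, chi =1 psi}.
  move=> Fp; have Gp : G (sval p) by apply: FG; exists p.
  by have [chi [pchi chis]] := filter_ex (filterI Gp (psiG s)); exists chi.
exists psi; split=> [n|j].
  have [p Fp] := F0; have [chi pchi chiE] := meets p (x n ++ y n) Fp.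
  have [s [psi1 [_ pE]]] := svalP p.
  move: pchi; rewrite pE => -[/(_ n) chin _].
  rewrite -(@eq_ev _ chi psi) -1?(@eq_ev _ chi psi (y n)) //.
    by move=> a ya; apply: chiE; rewrite mem_cat ya orbT.
  by move=> a xa; apply: chiE; rewrite mem_cat xa.
have [p [Fp [n pn]]] := FD (D j) (ex_intro2 _ _ j I erefl).
have [chi pchi chiE] := meets p (h j n) Fp.
by exists n; rewrite -(eq_ev chiE) pn.
Qed.
End Forcing.

(** * The recursion *)

(** As [Phi t] depends only on values below [t], the recursion may fill in [x0] elsewhere. *)
Lemma wf_choice (T X : Type) (lt : T -> T -> Prop) (x0 : X)
    (Phi : T -> (T -> X) -> X -> Prop) :
  well_founded lt ->
  (forall t g g' v, (forall s, lt s t -> g s = g' s) -> Phi t g v -> Phi t g' v) ->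
  (forall t g, exists v, Phi t g v) ->
  exists g, forall t, Phi t g (g t).
Proof.
move=> wf Phi_ext Phi_ex.
pose step t g := sval (cid (Phi_ex t g)).
pose ext t (r : forall s, lt s t -> X) s := if pselect (lt s t) is left h then r s h else x0.
pose g := Fix wf (fun=> X) (fun t r => step t (ext t r)).
exists g => t; rewrite {2}/g Fix_eq; last first.
  move=> s r r' rr'; congr step; apply/funext => u.
  by rewrite /ext; case: pselect.
rewrite -/g /step; case: cid => v /=; apply: Phi_ext => s st.
by rewrite /ext; case: pselect.
Qed.

Lemma free_ultrafilter : exists p : set (set nat),
  UltraFilter p /\ forall m, p [set n | m <= n].
Proof.
have [p [pU pF]] := ultraFilterLemma eventually_filter.
by exists p; split => // m; apply: pF; exists m.
Qed.

Lemma unbounded_enumeration (P : nat -> Prop) :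
  (forall m, exists n, m <= n /\ P n) -> exists e : nat -> nat, injective e /\ forall k, P (e k).
Proof.
move=> /choice[nxt nxtP].
pose e := fix e k := if k is k'.+1 then nxt (e k').+1 else nxt 0.
have e_inc : {homo e : i j / i < j}.
  by apply: homo_ltn; [exact: ltn_trans|move=> i /=; exact: (nxtP _).1].
exists e; split=> [i j eij|[|k]]; last 2 first.
- exact: (nxtP _).2.
- exact: (nxtP _).2.
by case: (ltngtP i j) => // /e_inc; rewrite eij ltnn.
Qed.

Lemma lift_seq (T : eqType) (P : T -> Prop) (s : seq T) :
  {in s, forall t, P t} -> exists s' : seq {t | P t}, map (@proj1_sig T P) s' = s.
Proof.
elim: s => [|t s IH] sP; first by exists [::].
have [|s' <-] := IH; first by move=> u us; apply: sP; rewrite inE us orbT.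
by exists (exist _ t (sP t (mem_head _ _)) :: s').
Qed.

(** Stands in when [E a] does not code an independent pair. *)
Lemma indep_default : exists x y : nat -> seq continuum, indep x y.
Proof.
have [t tI] := embeds_nat_continuum.
exists (fun n => [:: t n.*2]), (fun n => [:: t n.*2.+1]).
apply: (@indep_fresh _ _ _ (fun n => map t (iota 0 n.*2))).
  have tin k n : k < n -> t k \in map t (iota 0 n).
    by move=> kn; apply: map_f; rewrite mem_iota.
  move=> m n mn; have m2n : m.*2.+1 < n.*2 by rewrite -doubleS leq_double.
  by split=> a; rewrite inE => /eqP->; apply: tin => //; exact: ltnW.
move=> n l ls.
have tl k : n.*2 <= k -> ind l (t k) = false.
  move=> nk; apply/negbTE/negP => /ind_mem/ls/mapP[i].
  by rewrite mem_iota /= => ik /tI ki; move: ik; rewrite -ki ltnNge nk.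
split.
- move=> /(congr1 (@^~ (t n.*2))); rewrite tl //.
  by rewrite /ind ev_seq1 /= eqxx.
- move=> /(congr1 (@^~ (t n.*2.+1))); rewrite tl //.
  by rewrite /ind ev_seq1 /= eqxx.
- move=> /(congr1 (@^~ (t n.*2))); rewrite tl // ind_cat /ind !ev_seq1 /= eqxx.
  by case: eqP => // /tI/eqP; rewrite eq_sym ltn_eqF.
Qed.

(** * One step of the transfinite recursion *)

Section Coordinates.
Variable lt : continuum -> continuum -> Prop.
Hypothesis lt_wf : well_founded lt.
Hypothesis lt_tr : forall x y z, lt x y -> lt y z -> lt x z.
Hypothesis lt_tot : forall x y, [\/ lt x y, x = y | lt y x].
Hypothesis lt_small : forall x, ~ embeds continuum {y | lt y x}.
Variable E : continuum -> nat -> seq continuum.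
Variable p : set (set nat).
Hypothesis pU : UltraFilter p.

Definition below xi : Prop := forall n z, z \in E xi n -> lt z xi.

Definition accum (phi : continuum -> continuum -> bool) xi (F : seq continuum) n : Prop :=
  forall b, b \in F -> ev (phi b) (E xi n) = phi b xi.

(** [E a] has two roles: its even and odd terms form a pair that coordinate [a] should hit, and as
    one sequence it should accumulate at the point [a]. *)
Definition coordinate a (phi : continuum -> continuum -> bool)
    (psi : continuum -> bool) : Prop :=
  let x n := E a n.*2 in let y n := E a n.*2.+1 in
  [/\ below a -> indep x y -> hits psi x y,
      forall xi, ~ lt xi a -> below xi -> p [set n | ev psi (E xi n) = psi xi]
    & forall xi F m, lt xi a -> below xi -> injective (fun n => ind (E xi n)) ->
        (forall b, b \in F -> lt b a) ->
        (forall k, exists n, k <= n /\ accum phi xi F n) ->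
        exists n, [/\ m <= n, accum phi xi F n & ev psi (E xi n) = psi xi]].

Lemma coordinate_ext a phi phi' psi :
  (forall b, lt b a -> phi b = phi' b) ->
  coordinate a phi psi -> coordinate a phi' psi.
Proof.
move=> pp [H1 H2 H3]; split=> // xi F m xia bxi inj Fa acc.
have accE n : accum phi xi F n <-> accum phi' xi F n.
  by split=> H b bF; have := H b bF; rewrite pp //; exact: Fa.
have [|n [mn /accE An psin]] := H3 xi F m xia bxi inj Fa; last by exists n.
by move=> k; have [n [kn /accE An]] := acc k; exists n.
Qed.

(** Values below [a] are kept. From [a] on, when [below xi] holds, [psi xi] is a limit along [p] of
    values determined at earlier indices, so it can be defined by recursion. *)
Lemma ultra_extension a (psi0 : continuum -> bool) : exists psi,
  (forall xi, lt xi a -> psi xi = psi0 xi) /\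
  forall xi, ~ lt xi a -> below xi -> p [set n | ev psi (E xi n) = psi xi].
Proof.
have [||psi psiP] := @wf_choice _ bool lt false (fun xi g v =>
  (lt xi a -> v = psi0 xi) /\
  (~ lt xi a -> below xi -> p [set n | ev g (E xi n) = v])) lt_wf.
- move=> xi g g' v gg' [H1 H2]; split=> // xia bxi.
  apply: filterS (H2 xia bxi) => n /= <-; apply: eq_ev => z zE.
  by apply/esym/gg'; exact: bxi zE.
- move=> xi g; case: (pselect (lt xi a)) => xia; first by exists (psi0 xi); split.
  have [pt|pf] := in_ultra_setVsetC [set n | ev g (E xi n)] pU.
    by exists true; split.
  by exists false; split=> // _ _; apply: filterS pf => n /negP/negbTE.
by exists psi; split=> xi; have [] := psiP xi.
Qed.

(** A requirement [(xi, F, m)] is met once the generic functional vanishes on some [xi :: E xi n]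
    with [m <= n] and [accum phi xi F n]; [small_index] bounds their number. The later change of
    values from [a] on does not affect vectors supported below [a]. *)
Lemma coordinate_exists a phi : martins_axiom -> exists psi, coordinate a phi psi.
Proof.
move=> MA; pose U := {b | lt b a}; pose J := (U * seq U * nat)%type.
have Jsmall := small_index (lt_small (x := a)).
have JT : embeds J continuum by have [//|/Jsmall] := embeds_total J continuum.
have [x [y [xy xyE]]] : exists x y, indep x y /\
    (indep (fun n => E a n.*2) (fun n => E a n.*2.+1) ->
     x = (fun n => E a n.*2) /\ y = (fun n => E a n.*2.+1)).
  case: (pselect (indep (fun n => E a n.*2) (fun n => E a n.*2.+1))) => H.
    by exists (fun n => E a n.*2), (fun n => E a n.*2.+1).
  by have [x [y xy]] := indep_default; exists x, y.
pose good xi F := injective (fun n => ind (E xi n)) /\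
  forall k, exists n, k <= n /\ accum phi xi F n.
have /choice[h hP] : forall j : J, exists h : nat -> seq continuum,
    let xi := sval j.1.1 in let F := map (@proj1_sig _ _) j.1.2 in
    injective (fun k => ind (h k)) /\ (good xi F -> forall k, exists n,
      [/\ j.2 <= n, accum phi xi F n & h k = xi :: E xi n]).
  move=> [[[xi xia] F'] m] /=; set F := map _ F'.
  case: (pselect (good xi F)) => [[EI acc]|H]; last first.
    have [t tI] := embeds_nat_continuum.
    exists (fun k => [:: t k]); split=> // k k' /(congr1 (@^~ (t k))).
    by rewrite /ind !ev_seq1 /= eqxx => /esym/eqP/tI.
  have [|e [eI eP]] := @unbounded_enumeration (fun n => m <= n /\ accum phi xi F n).
    move=> k; have [n [kn An]] := acc (maxn k m).
    by exists n; move: kn; rewrite geq_max => /andP[].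
  exists (fun k => xi :: E xi (e k)); split=> [k k' kk'|_ k]; last first.
    by exists (e k); have [] := eP k.
  apply/eI/EI/funext => z; have := congr1 (@^~ z) kk'.
  by rewrite /ind !ev_cons => /addbI.
have [psi0 [psi0P psi0h]] := generic_functional MA JT Jsmall xy (fun j => (hP j).1).
have [psi [psiE psiU]] := ultra_extension a psi0.
have evE xi n : lt xi a -> below xi -> ev psi (E xi n) = ev psi0 (E xi n).
  by move=> xia bxi; apply: eq_ev => z zE; apply: psiE; apply: lt_tr xia; exact: bxi zE.
exists psi; split=> // [ba ixy|xi F m xia bxi EI Fa acc].
  have [xE yE] := xyE ixy; rewrite xE yE in psi0P.
  move=> n; rewrite (@eq_ev _ psi psi0) 1?(@eq_ev _ psi psi0 (E a n.*2.+1)) ?psi0P //.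
    by move=> z /ba; exact: psiE.
  by move=> z /ba; exact: psiE.
have [F' F'E] := lift_seq Fa.
have [k hk] := psi0h (exist _ xi xia, F', m).
have [_ /(_ _ k)[|n [mn An hE]]] := hP (exist _ xi xia, F', m).
  by rewrite /= F'E; split.
exists n; rewrite /= F'E in An; split => //.
rewrite evE // psiE //; move: hk; rewrite hE ev_cons /=.
by case: (psi0 xi); case: (ev _ _).
Qed.

Lemma max_seq (b0 : continuum) (F : seq continuum) : exists2 b, b \in b0 :: F &
  forall c, c \in b0 :: F -> c = b \/ lt c b.
Proof.
elim: F b0 => [|b1 F IH] b0.
  by exists b0; rewrite ?mem_head // => c; rewrite inE => /eqP->; left.
have [b bF bmax] := IH b1.
have [b0b|b0b|bb0] := lt_tot b0 b.
- exists b; first by rewrite inE bF orbT.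
  by move=> c; rewrite inE => /orP[/eqP->|/bmax//]; right.
- exists b; first by rewrite inE bF orbT.
  by move=> c; rewrite inE => /orP[/eqP->|/bmax//]; left.
- exists b0; first exact: mem_head.
  move=> c; rewrite inE => /orP[/eqP->|/bmax[->|cb]]; [by left|by right|].
  by right; exact: lt_tr bb0.
Qed.

(** Induction on the size of [F]. If no coordinate in [F] is above [xi], all limits are attained on
    one member of [p]. Otherwise the largest one, [b], is above [xi], and genericity of [phi b] adds
    it to the others. *)
Lemma accum_unbounded phi xi (pfree : forall m, p [set n | m <= n]) :
  (forall a, coordinate a phi (phi a)) ->
  below xi -> injective (fun n => ind (E xi n)) ->
  forall F m, exists n, m <= n /\ accum phi xi F n.
Proof.
move=> phiP bxi EI F; have [k] := ubnP (size F); elim: k F => // k IH F Fk m.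
case: (pselect (exists2 b, b \in F & lt xi b)) => [[b0 b0F xib0]|noF]; last first.
  have accp G : {subset G <= F} -> p [set n | accum phi xi G n].
    elim: G => [|b G IHG] GF; first by apply: filterS filterT => n _ b.
    have [_ /(_ xi) pb _] := phiP b.
    have {}pb : p [set n | ev (phi b) (E xi n) = phi b xi].
      by apply: pb => // xib; apply: noF; exists b => //; apply: GF; exact: mem_head.
    have pG : p [set n | accum phi xi G n].
      by apply: IHG => c cG; apply: GF; rewrite inE cG orbT.
    apply: filterS (filterI pb pG) => n [nb nG] c; rewrite inE => /orP[/eqP->//|].
    exact: nG.
  by have [n [mn nF]] := filter_ex (filterI (pfree m) (accp F (fun _ => id))); exists n.
have [b bF bmax] : exists2 b, b \in F & forall c, c \in F -> c = b \/ lt c b.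
  by case: (F) b0F => // b1 G _; exact: max_seq.
have [_ _ /(_ xi [seq c <- F | c != b] m)] := phiP b.
case=> //.
- by have [<-//|b0b] := bmax _ b0F; exact: lt_tr b0b.
- move=> c; rewrite mem_filter => /andP[cb /bmax[cE|//]].
  by rewrite cE eqxx in cb.
- apply: IH; rewrite -ltnS; apply: leq_trans Fk; rewrite ltnS.
  rewrite size_filter -(count_predC (pred1 b) F) -[X in X < _]add0n ltn_add2r.
  by rewrite -has_count; apply/hasP; exists b => /=.
move=> n [mn nF nb]; exists n; split=> // c cF.
have [->//|cb] := eqVneq c b.
by apply: nF; rewrite mem_filter cb.
Qed.

End Coordinates.

Theorem generic_coordinates : martins_axiom ->
  exists phi : continuum -> continuum -> bool,
    (forall X : nat -> seq continuum, injective (fun n => ind (X n)) ->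
       exists xi, forall (F : seq continuum) m,
         exists n, m <= n /\ forall b, b \in F -> ev (phi b) (X n) = phi b xi) /\
    (forall x y : nat -> seq continuum, indep x y -> exists a, hits (phi a) x y).
Proof.
move=> MA; have [lt [wf tr tot small]] := continuum_order.
have [E EP] := sequence_enumeration tot small.
have [p [pU pfree]] := free_ultrafilter.
have [||phi phiP] := @wf_choice _ _ lt xpred0 (coordinate lt E p) wf.
- by move=> a phi phi' psi; exact: coordinate_ext.
- by move=> a phi; exact: coordinate_exists.
exists phi; split=> [X XI|x y xy].
  have [xi EX bxi] := EP X; exists xi => F m.
  have [||n [mn An]] := accum_unbounded tr tot pU pfree phiP (xi := xi) _ _ F m.
  - by rewrite /below EX.
  - by rewrite EX.
  by exists n; rewrite -EX.
(* The pair is interleaved into one sequence, as [coordinate] expects. *)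
have [a Ea ba] := EP (fun n => if odd n then y n./2 else x n./2).
have [hita _ _] := phiP a; exists a.
have xE : (fun n => E a n.*2) = x by apply/funext => n; rewrite Ea odd_double doubleK.
have yE : (fun n => E a n.*2.+1) = y.
  by apply/funext => n; rewrite Ea /= odd_double /= uphalf_double.
by rewrite xE yE in hita; apply: hita => //; rewrite /below Ea.
Qed.

(** * The group *)

Lemma nbhs_set_type_agree (G : set two_pow_continuum) (g : set_type G) (U : set (set_type G)) :
  nbhs g U -> exists F : seq continuum, forall g' : set_type G,
    (forall b, b \in F -> val g' b = val g b) -> U g'.
Proof.
move=> [_ [[W oW <-] Wg] WU].
pose N : set_system two_pow_continuum :=
  filter_from [set: seq continuum] (fun F => [set f | forall b, b \in F -> f b = val g b]).
have FN : Filter N.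
  apply: filter_from_filter; first by exists [::].
  move=> F1 F2 _ _; exists (F1 ++ F2) => // f fF.
  by split=> b bF; apply: fF; rewrite mem_cat bF ?orbT.
have : N --> (val g : two_pow_continuum).
  apply/cvg_sup => b U' [_ [[V oV <-] Vg] VU].
  by exists [:: b] => // f fb; apply: VU => /=; rewrite fb ?mem_head.
move=> /(_ W)[|F _ FW].
  by apply: open_nbhs_nbhs; split.
by exists F => g' g'F; apply: WU; exact: FW.
Qed.

Lemma continuous_coord (G : set two_pow_continuum) (b : continuum) :
  continuous (fun g : set_type G => val g b).
Proof.
move=> g; apply: (@continuous_comp _ _ _ (val : set_type G -> two_pow_continuum) (fun f => f b)).
  exact: initial_continuous.
exact: proj_continuous.
Qed.

Lemma nbhs_agree (G : set two_pow_continuum) (g : set_type G * set_type G) (F : seq continuum) :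
  nbhs g [set g' : set_type G * set_type G | forall b, b \in F ->
    val g'.1 b = val g.1 b /\ val g'.2 b = val g.2 b].
Proof.
elim: F => [|b F IH]; first by apply: filterS filterT => g' _ b.
have nb1 : nbhs g [set g' : set_type G * set_type G | val g'.1 b = val g.1 b].
  have : (fun g' : set_type G * set_type G => val g'.1 b) @ g --> val g.1 b.
    apply: (@continuous_comp _ _ _ fst (fun g : set_type G => val g b)).
      exact: cvg_fst.
    exact: continuous_coord.
  by move=> h; apply: (h [set val g.1 b]); exact: discrete_set1.
have nb2 : nbhs g [set g' : set_type G * set_type G | val g'.2 b = val g.2 b].
  have : (fun g' : set_type G * set_type G => val g'.2 b) @ g --> val g.2 b.
    apply: (@continuous_comp _ _ _ snd (fun g : set_type G => val g b)).
      exact: cvg_snd.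
    exact: continuous_coord.
  by move=> h; apply: (h [set val g.2 b]); exact: discrete_set1.
apply: filterS (filterI (filterI nb1 nb2) IH) => g' [[g'1 g'2] g'F] c.
by rewrite inE => /orP[/eqP->|]; [split|exact: g'F].
Qed.

Lemma infinite_pigeonhole (M : eqType) (c : nat -> M) :
  finite_set (range c) -> exists v, forall m, exists n, m <= n /\ c n = v.
Proof.
move=> /finite_seqP[r rE]; apply: contrapT => /forallNP nv.
have /choice[k kP] : forall v, exists k, forall n, k <= n -> c n <> v.
  move=> v; have /existsNP[k kP] := nv v.
  by exists k => n kn cn; apply: kP; exists n.
pose m := \max_(v <- r) k v.
have : range c (c m) by exists m.
rewrite rE /= => cr.
have kmax v : v \in r -> k v <= m by move=> vr; rewrite /m (big_rem v) //= leq_maxl.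
exact: (kP (c m) m (kmax _ cr)).
Qed.

Lemma infinite_escape (M : Type) (c : nat -> M) (H : set M) :
  injective c -> finite_set H -> exists n, ~ H (c n).
Proof.
move=> cI Hfin; apply: contrapT => /forallNP cH; apply: infinite_nat.
have cfin : finite_set (range c).
  by apply: sub_finite_set Hfin => _ [n _ <-]; apply: contrapT; exact: cH.
apply: card_le_finite cfin.
have /card_eqPle[] // : (range c #= [set: nat])%card by apply: inj_card_eq; exact: in2W.
Qed.

Lemma injective_eventually (e : nat -> nat) : injective e ->
  forall c, exists m, forall k, m <= k -> c <= e k.
Proof.
move=> eI; elim=> [|c [m mP]]; first by exists 0.
case: (pselect (exists k, e k = c)) => [[k ek]|nk].
  exists (maxn m k.+1) => j; rewrite geq_max => /andP[/mP mj kj].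
  rewrite ltn_neqAle mj andbT; apply: contraTneq kj => cj.
  by rewrite -ltnNge ltnS (eI k j) // ek cj.
exists m => k /mP; rewrite leq_eqVlt => /orP[/eqP ck|//].
by case: nk; exists k.
Qed.

Section Group.
Variable phi : continuum -> continuum -> bool.

Definition pt (l : seq continuum) : two_pow_continuum := fun b => ev (phi b) l.

Definition group : set two_pow_continuum := range pt.

Lemma pt_ind l l' : ind l =1 ind l' -> pt l = pt l'.
Proof. by move=> ll'; apply/funext => b; exact: eq_ev_ind. Qed.

Lemma pt_cat l l' : pt (l ++ l') = (pt l + pt l')%R.
Proof. by apply/funext => b; exact: ev_cat. Qed.

Lemma subgroup_group : subgroup group.
Proof.
split; first by apply/mem_set; exists [::] => //; apply/funext => b; exact: ev_nil.
move=> u v /set_mem[l _ <-] /set_mem[l' _ <-]; apply/mem_set.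
exists (l ++ l') => //; rewrite pt_cat; congr (_ + _)%R.
Qed.

Lemma pt_in l : pt l \in group.
Proof. by apply/mem_set; exists l. Qed.

Definition gpt l : set_type group := SigSub (pt_in l).

Lemma gpt_surj : exists rep : set_type group -> seq continuum, forall g, pt (rep g) = val g.
Proof.
have /choice[rep repP] : forall g : set_type group, exists l, pt l = val g.
  move=> g; have [l _ lg] : range pt (val g) by apply/set_mem; exact: valP g.
  by exists l.
by exists rep.
Qed.

Definition span (s : seq continuum) : set two_pow_continuum :=
  [set pt l | l in [set l : seq continuum | {subset l <= s}]].

Lemma finite_span s : finite_set (span s).
Proof.
pose u := undup (s : seq (nat -> bool)).
apply: (@sub_finite_set _ _ (range (fun m : (size u).-tuple bool => pt (mask m u)))).
  move=> _ [l ls <-]; exists (map_tuple (ind l) (in_tuple u)) => //.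
  apply: pt_ind => z; rewrite -filter_mask.
  rewrite [LHS]indE count_filter.
  rewrite (@eq_count _ (predI (pred1 z) (ind l)) (fun w => ind l z && (w == z))); last first.
    by move=> w /=; case: eqP => [->|]; rewrite ?andbT ?andbF.
  case lz : (ind l z) => /=; last by rewrite count_pred0.
  by rewrite count_uniq_mem ?undup_uniq // mem_undup (ls z (ind_mem lz)).
apply: finite_image; exact: finite_finset.
Qed.


(** The hypothesis of [indep_fresh], moved from vectors to points so that it becomes an open
    condition. *)
Definition fresh s (g : set_type group * set_type group) : Prop :=
  [/\ ~ span s (val g.1), ~ span s (val g.2) & ~ span s (val g.1 + val g.2)%R].

(** [c i] avoids the finite span, then [c j] avoids the span and its translate by [c i]. *)
Lemma fresh_exists s (c : nat -> set_type group) : injective c ->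
  exists i j, fresh s (c i, c j).
Proof.
move=> cI; have vI : injective (fun n => val (c n)) by move=> i j /val_inj/cI.
have [i ci] := infinite_escape vI (finite_span s).
have [|j cj] := infinite_escape vI (H := span s `|` [set v | span s (val (c i) + v)%R]).
  rewrite finite_setU; split; first exact: finite_span.
  rewrite (_ : [set v | _] = (fun v => val (c i) + v)%R @` span s).
    exact/finite_image/finite_span.
  have K v : (val (c i) + (val (c i) + v))%R = v.
    by apply/funext => b; exact: addKb.
  by apply/seteqP; split=> [v Hv|_ [v Hv <-]]; [exists (val (c i) + v)%R|rewrite /= K].
by exists i, j; split=> // H; apply: cj; [left|right].
Qed.

(** Finitely many coordinates tell the points and their sum apart from the finite span. *)
Lemma open_fresh s : open (fresh s).
Proof.
rewrite openE => g [g1 g2 g12]; rewrite /interior.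
have [hs hsE] : exists hs : seq two_pow_continuum, span s = [set` hs].
  exact/finite_seqP/finite_span.
have differ (u v : two_pow_continuum) : exists b, u <> v -> u b <> v b.
  case: (pselect (u = v)) => [uv|uv]; first by exists point.
  apply: contrapT => /forallNP H; apply: uv; apply/funext => b.
  by apply: contrapT => ub; apply: (H b).
have /choice[d dP] : forall p : two_pow_continuum * two_pow_continuum,
    exists b, p.1 <> p.2 -> p.1 b <> p.2 b by move=> [u v]; exact: differ.
have {}dP u v : u <> v -> u (d (u, v)) <> v (d (u, v)) := dP (u, v).
pose F := [seq d (val g.1, h) | h <- hs] ++ [seq d (val g.2, h) | h <- hs] ++
  [seq d ((val g.1 + val g.2)%R, h) | h <- hs].
apply: filterS (nbhs_agree g F) => g' g'F.
have hsP h : span s h -> h \in hs by rewrite hsE.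
split=> Hs; have hin := hsP _ Hs.
- have /g'F[E _] : d (val g.1, val g'.1) \in F.
    by rewrite mem_cat (map_f (fun h => d (val g.1, h)) hin).
  by apply: (dP (val g.1) (val g'.1)); [move=> E'; apply: g1; rewrite E'|rewrite E].
- have /g'F[_ E] : d (val g.2, val g'.2) \in F.
    by rewrite !mem_cat (map_f (fun h => d (val g.2, h)) hin) orbT.
  by apply: (dP (val g.2) (val g'.2)); [move=> E'; apply: g2; rewrite E'|rewrite E].
- set u := (val g.1 + val g.2)%R; set v := (val g'.1 + val g'.2)%R in Hs hin.
  have /g'F[E1 E2] : d (u, v) \in F.
    by rewrite !mem_cat (map_f (fun h => d (u, h)) hin) !orbT.
  apply: (dP u v); first by move=> E'; apply: g12; rewrite -/u E'.
  by rewrite -[LHS]/(_ + _)%R -[RHS]/(_ + _)%R; congr addb; rewrite ?E1 ?E2.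
Qed.

Hypothesis phi_hits : forall x y, indep x y -> exists a, hits (phi a) x y.

(** In a finite group infinitely many generators share an image [v]. Their differences from [r 0]
    give an independent sequence of pairs at which every coordinate vanishes. *)
Lemma infinite_group : exists c : nat -> set_type group, injective c.
Proof.
suff /infiniteP/card_leP[f] : infinite_set (range pt).
  have fP n : val (f (SigSub (mem_set (I : [set: nat] n)))) \in group by exact: valP.
  exists (fun n => SigSub (fP n)) => m n [/val_inj/(inj (f := f))].
  by rewrite !inE => /(_ I I) [].
move=> Gfin; have [t tI] := embeds_nat_continuum.
have [|v tv] := @infinite_pigeonhole two_pow_continuum (fun n => pt [:: t n]).
  by apply: sub_finite_set Gfin => _ [n _ <-]; exists [:: t n].
have [e [eI eP]] := unbounded_enumeration tv.
pose r n := t (e n); have rI : injective r by move=> m n /tI/eI.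
have rin k n : k < n -> r k \in map r (iota 0 n).
  by move=> kn; apply: map_f; rewrite mem_iota.
pose x n := [:: r n.*2.+1; r 0]; pose y n := [:: r n.*2.+2; r 0].
have [|b bP] := phi_hits (x := x) (y := y).
  apply: (@indep_fresh _ _ _ (fun n => map r (iota 0 n.*2.+1))).
    move=> m n mn; have m2n : m.*2.+2 < n.*2.+1 by rewrite ltnS -doubleS leq_double.
    by split=> a; rewrite mem_seq2 => /orP[] /eqP->; apply: rin => //; exact: ltnW.
  move=> n l ls.
  have rl k : n.*2 < k -> ind l (r k) = false.
    move=> nk; apply/negbTE/negP => /ind_mem/ls/mapP[i].
    by rewrite mem_iota /= ltnS => ik /rI ki; move: ik; rewrite -ki leqNgt nk.
  have rE i j : (r i == r j) = (i == j) by exact: inj_eq.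
  split.
  - move=> /(congr1 (@^~ (r n.*2.+1))); rewrite rl //.
    by rewrite /ind !ev_cons ev_nil /= !rE eqxx.
  - move=> /(congr1 (@^~ (r n.*2.+2))); rewrite rl; last by rewrite ltnW.
    by rewrite /ind !ev_cons ev_nil /= !rE eqxx.
  - move=> /(congr1 (@^~ (r n.*2.+1))); rewrite rl // ind_cat.
    have E : (n.*2.+2 == n.*2.+1) = false by rewrite gtn_eqF.
    by rewrite /ind !ev_cons !ev_nil /= !rE eqxx E.
have pE n : pt [:: r n] = v by exact: eP.
have := bP 0; rewrite /x /y !ev_cons ev_nil !addbF.
have vb n : phi b (r n) = v b by rewrite -(pE n) /pt ev_seq1.
by rewrite !vb !addbb.
Qed.

(* Translating the tail of the sequence by a candidate accumulation point keeps
   it independent, so some coordinate separates it from that point. *)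
Lemma scattered_sequence (A : nat -> set (set_type group * set_type group)) :
  (forall n s, exists2 g, A n g & fresh s g) ->
  exists g, [/\ forall n, A n (g n), injective g &
    forall l : set_type group * set_type group, exists b n0, forall n, n0 <= n ->
      ~ (val (g n).1 b = val l.1 b /\ val (g n).2 b = val l.2 b)].
Proof.
move=> Afresh; have [rep repP] := gpt_surj.
have /choice[f fP] : forall p : nat * seq continuum, exists g, A p.1 g /\ fresh p.2 g.
  by move=> [n s]; have [g Ag gs] := Afresh n s; exists g.
pose next n s := let g := f (n, s) in s ++ rep g.1 ++ rep g.2.
(* [s n] collects the supports of all earlier terms, over which the next one is chosen fresh. *)
pose s := fix s n := if n is m.+1 then next m (s m) else [::].
pose g n := f (n, s n); pose x n := rep (g n).1; pose y n := rep (g n).2.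
have sS n : s n.+1 = s n ++ x n ++ y n by [].
have smono m n : m <= n -> {subset s m <= s n}.
  move=> /subnK<-; elim: (n - m) => // k IH a /IH; rewrite addSn sS mem_cat => ->.
  by [].
have xs m n : m < n -> {subset x m <= s n}.
  by move=> mn a ax; apply: (smono _ _ mn); rewrite sS !mem_cat ax !orbT.
have ys m n : m < n -> {subset y m <= s n}.
  by move=> mn a ay; apply: (smono _ _ mn); rewrite sS !mem_cat ay !orbT.
have gE n : val (g n).1 = pt (x n) /\ val (g n).2 = pt (y n) by split; rewrite repP.
have nspan n l z : {subset l <= s n} -> z \in [:: x n; y n; x n ++ y n] ->
    ind z =1 ind l -> False.
  move=> ls zn zl; have [] := (fP (n, s n)).2.
  rewrite -/(g n) (gE n).1 (gE n).2 -pt_cat => n1 n2 n3.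
  have Hz : span (s n) (pt z) by exists l => //; apply: pt_ind => a; rewrite zl.
  by move: zn Hz; rewrite !inE => /or3P[] /eqP->.
exists g; split=> [n|m n gmn|l]; first exact: (fP (n, s n)).1.
  have neq i j : i < j -> g i <> g j.
    move=> ij gij; have [n1 _ _] := (fP (j, s j)).2; apply: n1.
    by rewrite -/(g j) -gij (gE i).1; exists (x i) => //; exact: xs.
  by case: (ltngtP m n) => // /neq; rewrite gmn.
pose a := rep l.1; pose c := rep l.2.
(* Each entry of [a] and [c] eventually either lies in [s n] or is absent from [x n] and [y n]; [n0]
   bounds these stages. *)
have /choice[k kP] : forall t, exists k, forall n, k <= n ->
    t \in x n ++ y n -> t \in s n.
  move=> t; case: (pselect (exists k, t \in s k)) => [[k tk]|nk].
    by exists k => n kn _; exact: smono tk.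
  exists 0 => n _ txy; case: nk; exists n.+1.
  by rewrite sS mem_cat txy orbT.
pose n0 := \max_(t <- a ++ c) k t.
have n0P n t : n0 <= n -> t \in x n ++ y n -> t \in a ++ c -> t \in s n.
  move=> n0n txy tac; apply: (kP t) => //; apply: leq_trans n0n.
  by rewrite /n0 (big_rem t) //= leq_maxl.
(* So entries of [a] and [c] outside [s n] can be erased from [l'], and translation preserves
   freshness. *)
have shift n z l' : n0 <= n -> {subset z <= x n ++ y n} ->
    {subset l' <= s n ++ a ++ c} -> ind z =1 ind l' ->
    exists2 l'', {subset l'' <= s n} & ind z =1 ind l''.
  move=> n0n zxy l's zl; exists [seq t <- l' | t \in s n].
    by move=> t; rewrite mem_filter => /andP[].
  move=> t; rewrite /ind ev_filter.
  have [ts|ts] := boolP (t \in s n).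
    rewrite -[LHS]/(ind z t) zl; apply: eq_ev => w _ /=.
    by case: eqP => [->|_]; rewrite ?ts ?andbF.
  rewrite [RHS]ev_false; last first.
    by move=> w _ /=; apply/negP => /andP[ws /eqP wt]; rewrite -wt ws in ts.
  apply/negbTE/negP => zt; case/negP: ts.
  have tz : t \in z by exact: ind_mem.
  have : t \in s n ++ a ++ c by apply: l's; apply: ind_mem; rewrite -zl.
  rewrite mem_cat => /orP[//|]; apply: n0P => //; exact: zxy.
have [|b bP] := phi_hits (x := fun i => x (n0 + i) ++ a) (y := fun i => y (n0 + i) ++ c).
  apply: (@indep_fresh _ _ _ (fun i => s (n0 + i) ++ a ++ c)).
    move=> i j ij; have nij : n0 + i < n0 + j by rewrite ltn_add2l.
    split=> t; rewrite !mem_cat => /orP[tz|->]; rewrite ?orbT //.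
      by rewrite (xs _ _ nij _ tz).
    by rewrite (ys _ _ nij _ tz).
  move=> i l' l's; have n0i := leq_addr i n0.
  have bad z d : z \in [:: x (n0 + i); y (n0 + i); x (n0 + i) ++ y (n0 + i)] ->
      {subset d <= a ++ c} -> ind (z ++ d) =1 ind l' -> False.
    move=> zn dac zl; have [|||l'' l''s zl''] := shift (n0 + i) z (l' ++ d) n0i.
    - move: zn; rewrite !inE => /or3P[] /eqP-> t; rewrite mem_cat // => ->; rewrite ?orbT //.
    - move=> t; rewrite mem_cat => /orP[/l's//|/dac].
      by rewrite [in X in _ -> X]mem_cat => ->; rewrite orbT.
    - by move=> t; rewrite ind_cat -zl ind_cat addbK.
    exact: nspan l''s zn zl''.
  split=> zl.
  - by apply: (bad (x (n0 + i)) a); rewrite ?inE ?eqxx ?zl // => t ta; rewrite mem_cat ta.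
  - by apply: (bad (y (n0 + i)) c); rewrite ?inE ?eqxx ?orbT ?zl // => t ta; rewrite mem_cat ta orbT.
  - apply: (bad (x (n0 + i) ++ y (n0 + i)) (a ++ c)); rewrite ?inE ?eqxx ?orbT // => t.
    by rewrite -zl !ind_cat addbACA.
exists b, n0 => n /subnKC nE [e1 e2]; have := bP (n - n0).
rewrite nE !ev_cat.
have -> : ev (phi b) (x n) = ev (phi b) a.
  by rewrite -[LHS]/(pt (x n) b) -(gE n).1 e1 -repP.
have -> : ev (phi b) (y n) = ev (phi b) c.
  by rewrite -[LHS]/(pt (y n) b) -(gE n).2 e2 -repP.
by rewrite !addbb.
Qed.

End Group.

(** * Topology of the group and its square *)

Section GroupTopology.
Variable phi : continuum -> continuum -> bool.
Local Notation G := (group phi).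

(** Without a finite subcover, choose [y n] outside the members of code at most [n]. Either one
    value recurs infinitely often, or distinct values form a sequence [w] with an accumulation
    point; a member around that point catches some [y n] with [n] at least its code. *)
Lemma group_countably_compact :
  (forall X : nat -> seq continuum, injective (fun n => ind (X n)) ->
     exists xi, forall (F : seq continuum) m,
       exists n, m <= n /\ forall b, b \in F -> ev (phi b) (X n) = phi b xi) ->
  countably_compact (set_type G).
Proof.
move=> phi_accum J D f /countable_injP[code codeI] fo cov.
apply: contrapT => nofin.
have /choice[y yP] : forall n, exists y, forall i, D i -> code i <= n -> ~ f i y.
  move=> n; apply: contrapT => /forallNP H; apply: nofin.
  have Dfin : finite_set [set i | D i /\ code i <= n].
    have : finite_set (code @` [set i | D i /\ code i <= n]).
      by apply: (@sub_finite_set _ _ `I_n.+1) (finite_II _) => _ [i [_ ?] <-].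
    apply: card_le_finite.
    have /card_eqPle[] // : (code @` [set i | D i /\ code i <= n] #=
        [set i | D i /\ code i <= n])%card.
    apply: inj_card_eq => i j; rewrite !inE => -[Di _] [Dj _].
    by apply: codeI; rewrite inE.
  exists (fset_set [set i | D i /\ code i <= n]) => [i|y _].
    by rewrite in_fset_set // !inE => -[].
  have /existsNP[i] := H y; move=> /not_implyP[Di] /not_implyP[ci /contrapT fi].
  by exists i => //=; rewrite in_fset_set // inE.
have caught v : exists2 i, D i & f i v by have [i Di fi] := cov v I; exists i.
case: (pselect (finite_set (range y))) => [|yinf].
  move=> /infinite_pigeonhole[v vP]; have [i Di fi] := caught v.
  by have [n [cn yn]] := vP (code i); apply: (yP n i) => //; rewrite yn.
have /infiniteP/card_leP[u] := yinf.
pose w n := val (u (SigSub (mem_set (I : [set: nat] n)))).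
have wI : injective w.
  move=> m n /val_inj/(inj (f := u)).
  by rewrite !inE => /(_ I I) [].
have /choice[e eP] : forall k, exists n, y n = w k.
  move=> k; have [n _ yn] : range y (w k) by apply: set_mem; exact: valP.
  by exists n.
have eI : injective e by move=> j k ejk; apply: wI; rewrite -!eP ejk.
have [rep repP] := gpt_surj phi.
have [|xi xiP] := phi_accum (fun k => rep (w k)).
  move=> j k jk; apply: wI; apply: val_inj; rewrite -!repP.
  by apply: pt_ind => z; rewrite jk.
have [i Di fi] := caught (gpt phi [:: xi]).
have [F FP] : exists F : seq continuum, forall g : set_type G,
    (forall b, b \in F -> val g b = val (gpt phi [:: xi]) b) -> f i g.
  by apply: nbhs_set_type_agree; apply: open_nbhs_nbhs; split => //; exact: fo.
(* [e] need not be increasing, but an injective map tends to infinity. *)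
have [m mP] := injective_eventually eI (code i).
have [k [mk kF]] := xiP F m.
apply: (yP (e k) i) => //; first exact: mP.
apply: FP => b bF; rewrite eP -repP [LHS]kF //.
by rewrite /= /pt ev_seq1.
Qed.

Hypothesis phi_hits : forall x y, indep x y -> exists a, hits (phi a) x y.

(** Fresh pairs [(x i, x j)] with growing [i] and [j] form a scattered sequence, although they would
    converge to [(l, l)]. *)
Lemma group_no_convergent_sequence :
  ~ exists x : nat -> set_type G, nontrivial_convergent_sequence x.
Proof.
move=> [x [xI [l xl]]].
have [n s|g [gP _ gl]] := @scattered_sequence phi phi_hits (fun n =>
    [set g | exists i j, [/\ n <= i, n <= j & g = (x i, x j)]]).
  have [|i [j ij]] := @fresh_exists phi s (fun k => x (n + k)).
    by move=> i j /xI/addnI.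
  by exists (x (n + i), x (n + j)) => //; exists (n + i), (n + j); rewrite !leq_addr.
have [b [n0 n0P]] := gl (l, l).
have [M _ MP] : \forall n \near \oo, val (x n) b = val l b.
  have /(_ [set val l b]) : (fun n => val (x n) b) @ \oo --> val l b.
    apply: (@cvg_comp _ _ _ x (fun g : set_type G => val g b) _ _ _ xl).
    exact: continuous_coord.
  by apply; exact: discrete_set1.
have [i [j [ni nj gij]]] := gP (maxn n0 M).
apply: (n0P (maxn n0 M)); first exact: leq_maxl.
move: ni nj; rewrite gij !geq_max => /andP[_ Mi] /andP[_ Mj].
by split; exact: MP.
Qed.

(** The open set [fresh s] is nonempty since the group is infinite, so a dense [A] contains a
    scattered sequence, which has no limit point. *)
Lemma group_square_not_countably_pracompact :
  ~ countably_pracompact (set_type G * set_type G)%type.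
Proof.
move=> [A Adense Alim].
have [c cI] := infinite_group phi_hits.
have [n s|g [gA gI gl]] := @scattered_sequence phi phi_hits (fun=> A).
  have [i [j ij]] := fresh_exists s cI.
  have [|g [gs Ag]] := Adense (fresh s) _ (@open_fresh phi s).
    by exists (c i, c j).
  by exists g.
have [||l lP] := Alim (range g).
- by move=> _ [n _ <-].
- move=> /(infinite_escape gI)[n]; apply.
  by exists n.
have [b [n0 n0P]] := gl l.
have /choice[d dP] : forall n, exists d, g n <> l ->
    ~ (val (g n).1 d = val l.1 d /\ val (g n).2 d = val l.2 d).
  move=> n; case: (pselect (g n = l)) => [gnl|gnl]; first by exists point.
  apply: contrapT => /forallNP H; apply: gnl.
  have E d : val (g n).1 d = val l.1 d /\ val (g n).2 d = val l.2 d.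
    by have /not_implyP[_ /contrapT] := H d.
  rewrite [g n]surjective_pairing [l]surjective_pairing; congr pair;
    by apply: val_inj; apply/funext => d; have [] := E d.
(* [b] rules out the terms from [n0] on, and the coordinates [d n] rule out the finitely many
   earlier ones other than [l]. *)
have [z [gnl [n _ gz] agree]] := lP _ (nbhs_agree l (b :: map d (iota 0 n0))).
rewrite -{z}gz in gnl agree.
have [nn0|n0n] := ltnP n n0.
  apply: (dP n); first exact/eqP.
  by apply: agree; rewrite inE map_f ?orbT // mem_iota.
by apply: (n0P n n0n); apply: agree; exact: mem_head.
Qed.

End GroupTopology.

Theorem theorem1p1 :
  martins_axiom ->
  exists G : set two_pow_continuum,
    [/\ subgroup G,
        countably_compact (set_type G),
        ~ (exists x : nat -> set_type G, nontrivial_convergent_sequence x)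
      & ~ countably_pracompact (set_type G * set_type G)%type].
Proof.
move=> /generic_coordinates[phi [phi_accum phi_hits]].
exists (group phi); split.
- exact: subgroup_group.
- exact: group_countably_compact.
- exact: group_no_convergent_sequence.
- exact: group_square_not_countably_pracompact.
Qed.
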